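(* For every $A\in\mathrm{Mat}_{m,n}$ and every $\tau>0$, $$\dim_H\mathrm{Sing}_A(\psi_\tau)\le\lim_{\delta\searrow0}\liminf_{T\to\infty}\frac{\displaystyle\int_1^T r_{A,\tau}(S;\delta)\,\frac{dS}{S}-\log\mathcal N_A(T^{-\tau},T)}{(1+\tau)\log T}.$$
   Context: Let $m,n\in\mathbb N$, $d=m+n$, $\mathbb R_+=(0,\infty)$, and let $\mathrm{Mat}_{m,n}$ be the set of real $m\times n$ matrices. $|\cdot|$ is the supremum norm. $\mathbb T^m=\mathbb R^m/\mathbb Z^m$ carries the quotient supremum metric, and $\dim_H$ is Hausdorff dimension. For a function $\psi:\mathbb R_+\to\mathbb R_+$, $D_A(\psi)$ is the set of $\mathbf b\in\mathbb T^m$ such that for every sufficiently large real $T$ there is $(\mathbf p,\mathbf q)\in\mathbb Z^m\times\mathbb Z^n$ with $|A\mathbf q-\mathbf p-\mathbf b|\le\psi(T)$ and $|\mathbf q|\le T$. $\psi_\tau(T):=T^{-\tau}$, and $\mathrm{Sing}_A(\psi_\tau):=\bigcap_{c>0}D_A(c\psi_\tau)$. $u_A=\begin{pmatrix}I_m&A\\0&I_n\end{pmatrix}$, $a_t=\mathrm{diag}(e^{t/m}I_m,e^{-t/n}I_n)$. For a lattice $\Lambda\subset\mathbb R^d$, $\lambda_i(\Lambda)$ is its $i$-th successive minimum relative to $[-1,1]^d$ (the infimum of $\lambda>0$ such that $\lambda[-1,1]^d\cap\Lambda$ contains $i$ linearly independent vectors), and $\lambda_i(t):=\lambda_i(a_tu_A\mathbb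 Z^d)$. For $R,Q>0$, $$t_{R,Q}:=\frac{mn}{d}\log\frac QR,\qquad \mathcal N_A(R,Q):=\prod_{i=1}^d\max\left\{\frac{Q^{n/d}R^{m/d}}{\lambda_i(t_{R,Q})},1\right\}.$$ For $\delta>0$, $$r_{A,\tau}(T;\delta):=\#\left\{1\le i\le d:\ \lambda_i\left(\tfrac{mn(1+\tau)}{d}\log T\right)<\delta\,T^{(n-m\tau)/d}\right\}.$$ *)

(* Defs.v *)
From HB Require Import structures.
From mathcomp Require Import all_boot all_order all_algebra.
From mathcomp Require Import all_classical all_reals all_analysis.

Set Implicit Arguments.
Unset Strict Implicit.
Unset Printing Implicit Defensive.

Import Order.TTheory GRing.Theory Num.Theory.
Import numFieldNormedType.Exports.

Local Open Scope classical_set_scope.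
Local Open Scope ring_scope.

Section HausdorffDimension.
Context {R : realType} {X : metricType R}.
Local Open Scope ereal_scope.
Implicit Types (E : set X) (s delta : R).

(* The diameter of the empty set is -oo. *)
Definition diam E : \bar R :=
  ereal_sup [set (mdist x.1 x.2)%:E | x in E `*` E].

(* Empty sets of the cover are left out of the sum, so they contribute 0 also
   for s = 0, while a nonempty set of diameter 0 then contributes 0 `^ 0 = 1. *)
Definition hausdorff_premeasure s delta E : \bar R :=
  ereal_inf [set \sum_(i <oo | U i != set0) diam (U i) `^ s
            | U in [set U : nat -> set X |
                     E `<=` \bigcup_i U i /\
                     forall i, diam (U i) <= delta%:E]].

Definition hausdorff_measure s E : \bar R :=
  ereal_sup [set hausdorff_premeasure s delta E
            | delta in [set delta | (0 < delta)%R]].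

Definition hausdorff_dim E : \bar R :=
  ereal_inf [set s%:E | s in [set s | (0 <= s)%R /\ hausdorff_measure s E = 0]].

End HausdorffDimension.

Definition int_vector (R : realType) (k : nat) : pred 'cV[R]_k :=
  fun v => v \is a mxOver Num.int.
Arguments int_vector {R k}.

Fact int_vector_zmod_closed (R : realType) (k : nat) :
  zmod_closed (@int_vector R k).
Proof.
split=> [|u v /mxOverP uint /mxOverP vint].
  by apply/mxOverP => i j; rewrite mxE int_num0.
by apply/mxOverP => i j; rewrite !mxE rpredB.
Qed.

HB.instance Definition _ (R : realType) (k : nat) :=
  GRing.isZmodClosed.Build 'cV[R]_k (@int_vector R k)
    (@int_vector_zmod_closed R k).

Definition torus (R : realType) (m : nat) : Type :=
  Quotient.quot (GRing.ZmodClosed.clone _ (@int_vector R m) _).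

Section TorusMetric.
Context {R : realType} {m : nat}.
Implicit Types (u v : 'cV[R]_m).

HB.instance Definition _ := GRing.Zmodule.on (torus R m).
HB.instance Definition _ := EqQuotient.on (torus R m).

Definition torus_pi v : torus R m := (\pi v)%qT.

Definition torus_lift (x : torus R m) : 'cV[R]_m := repr x.

Definition torus_norm (x : torus R m) : R :=
  inf [set `|v| | v in [set v | torus_pi v = x]].

Lemma torus_liftK x : torus_pi (torus_lift x) = x.
Proof. exact: reprK. Qed.

Lemma torus_piN v : torus_pi (- v) = - torus_pi v.
Proof. exact: (@pi_oppr _ _ 0 -%R +%R (torus R m)). Qed.

Lemma torus_piD u v : torus_pi (u + v) = torus_pi u + torus_pi v.
Proof. exact: (@pi_addr _ _ 0 -%R +%R (torus R m)). Qed.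

Lemma torus_pi0 : torus_pi 0 = 0.
Proof. exact: (@pi_zeror _ _ 0 -%R +%R (torus R m)). Qed.

Lemma torus_pi_eq u v :
  (torus_pi u = torus_pi v) <-> int_vector (u - v).
Proof.
rewrite -[int_vector _]/(Quotient.equiv
  (GRing.ZmodClosed.clone _ (@int_vector R m) _) u v).
by split => [/eqmodP//|?]; apply/eqmodP.
Qed.

Lemma torus_norm_le v : torus_norm (torus_pi v) <= `|v|.
Proof.
apply: ge_inf; last by exists v.
by exists 0 => _ [u _ <-]; exact: normr_ge0.
Qed.

Lemma torus_norm_ge0 x : 0 <= torus_norm x.
Proof.
apply: lb_le_inf; last by move=> _ [u _ <-]; exact: normr_ge0.
by exists `|torus_lift x|; exists (torus_lift x) => //; exact: torus_liftK.
Qed.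

Lemma torus_norm_adherent x (e : R) : 0 < e ->
  exists2 v, torus_pi v = x & `|v| < torus_norm x + e.
Proof.
move=> e0; set N := [set `|v| | v in [set v | torus_pi v = x]].
have infN : has_inf N.
  split; last by exists 0 => _ [u _ <-]; exact: normr_ge0.
  by exists `|torus_lift x|; exists (torus_lift x) => //; exact: torus_liftK.
by have [_ [v vx <-] ve] := inf_adherent e0 infN; exists v.
Qed.

Lemma torus_norm0 : torus_norm 0 = 0.
Proof.
apply/eqP; rewrite eq_le torus_norm_ge0 andbT.
by rewrite -torus_pi0 (le_trans (torus_norm_le 0))// normr0.
Qed.

Lemma torus_normN x : torus_norm (- x) = torus_norm x.
Proof.
suff H y : torus_norm (- y) <= torus_norm y.
  by apply/eqP; rewrite eq_le H /= -{1}[x]opprK H.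
apply/ler_addgt0Pr => e e0.
have [v <- /ltW ve] := torus_norm_adherent y e0.
by rewrite (le_trans _ ve)// -torus_piN -[leRHS]normrN torus_norm_le.
Qed.

Lemma torus_normD x y : torus_norm (x + y) <= torus_norm x + torus_norm y.
Proof.
apply/ler_addgt0Pr => e e0.
have e20 : 0 < e / 2 by rewrite divr_gt0.
have [u <- /ltW ue] := torus_norm_adherent x e20.
have [v <- /ltW ve] := torus_norm_adherent y e20.
rewrite -torus_piD (le_trans (torus_norm_le _))// (le_trans (ler_normD _ _))//.
by rewrite [e in leRHS]splitr addrACA lerD.
Qed.

Lemma int_vector_norm_lt1 v : int_vector v -> `|v| < 1 -> v = 0.
Proof.
move=> /mxOverP vint v1; apply/matrixP => i j; rewrite mxE.
apply/eqP; rewrite -[_ == 0]negbK; apply/negP => vij0.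
have := norm_intr_ge1 (vint i j) vij0; apply/negP; rewrite -ltNge.
apply: le_lt_trans v1; rewrite [leRHS]/Num.norm /= mx_normrE.
by apply/bigmax_geP; right; exists (i, j).
Qed.

Lemma torus_norm_eq0 x : torus_norm x = 0 -> x = 0.
Proof.
move=> x0.
have h0 : 0 < 1 / 2 :> R by rewrite divr_gt0.
have [u ux] := torus_norm_adherent x h0; rewrite x0 add0r => u1.
have [->|u0] := eqVneq x 0; first by [].
have {}u0 : 0 < `|u|.
  by rewrite normr_gt0; apply: contra_neq u0 => u0; rewrite -ux u0 torus_pi0.
have [v vx] := torus_norm_adherent x u0; rewrite x0 add0r => vu.
suff uv : u = v by rewrite uv ltxx in vu.
apply/eqP; rewrite -subr_eq0; apply/eqP/int_vector_norm_lt1.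
  by apply/torus_pi_eq; rewrite ux vx.
rewrite (le_lt_trans (ler_normB _ _))// [ltRHS]splitr ltrD//.
exact: lt_trans vu u1.
Qed.

Let torus_dist (x y : torus R m) : R := torus_norm (x - y).

Let torus_distxx x : torus_dist x x = 0.
Proof. by rewrite /torus_dist subrr torus_norm0. Qed.

Let torus_dist_eq0 x y : torus_dist x y = 0 -> x = y.
Proof. by move/torus_norm_eq0/eqP; rewrite subr_eq0 => /eqP. Qed.

Let torus_dist_sym x y : torus_dist x y = torus_dist y x.
Proof. by rewrite /torus_dist -torus_normN opprB. Qed.

Let torus_dist_triangle y x z :
  torus_dist x z <= torus_dist x y + torus_dist y z.
Proof. by rewrite /torus_dist -(subrKA y) torus_normD. Qed.

HB.instance Definition _ := isMetric.Build R (torus R m)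
  torus_distxx torus_dist_eq0 torus_dist_sym torus_dist_triangle.

Lemma torus_mdistE (x y : torus R m) : mdist x y = torus_norm (x - y).
Proof. by []. Qed.

End TorusMetric.

Section SuccessiveMinima.
Context {R : realType} {d : nat}.
Implicit Types (L : set 'cV[R]_d) (i : nat).

Definition unit_cube : set 'cV[R]_d :=
  [set v | forall k, -1 <= v k ord0 <= 1].

(* i ranges over 1, ..., d: for i = 0 the value is 0, and for i > d it is the
   infimum of the empty set, again 0. *)
Definition successive_minimum L i : R :=
  inf [set l : R | 0 < l /\
    exists s : i.-tuple 'cV[R]_d,
      free s /\
      forall v, v \in s -> ([set l *: w | w in unit_cube] `&` L) v].

End SuccessiveMinima.

Section Approximation.
Context {R : realType} {m n : nat}.
Implicit Types (A : 'M[R]_(m, n)) (psi : R -> R) (t tau : R).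

(* |A q - p - b| is computed on a representative of b in R^m; since p ranges
   over Z^m, the choice of the representative does not matter. *)
Definition dirichlet_set A psi : set (torus R m) :=
  [set b | \forall T \near +oo,
    exists (p : 'cV[R]_m) (q : 'cV[R]_n),
      [/\ int_vector p, int_vector q,
          `|A *m q - p - torus_lift b| <= psi T & `|q| <= T]].

Definition power_fun tau : R -> R := fun T => T `^ (- tau).

Definition singular_set A psi : set (torus R m) :=
  \bigcap_(c in [set c : R | 0 < c]) dirichlet_set A (fun T => c * psi T).

Definition unipotent_mx A : 'M[R]_(m + n) := block_mx 1%:M A 0 1%:M.

Definition diagonal_flow t : 'M[R]_(m + n) :=
  block_mx (expR (t / m%:R))%:M 0 0 (expR (- t / n%:R))%:M.

Definition flow_lattice A t : set 'cV[R]_(m + n) :=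
  [set diagonal_flow t *m unipotent_mx A *m v
  | v in [set v | int_vector v]].

Definition flow_minimum A i t : R := successive_minimum (flow_lattice A t) i.

Definition flow_time (r q : R) : R :=
  (m * n)%:R / (m + n)%:R * ln (q / r).

Definition covering_product A (r q : R) : R :=
  \prod_(1 <= i < (m + n).+1)
    Num.max (q `^ (n%:R / (m + n)%:R) * r `^ (m%:R / (m + n)%:R)
             / flow_minimum A i (flow_time r q)) 1.

Definition small_minima_count A tau (T delta : R) : nat :=
  size [seq i <- iota 1 (m + n) |
         flow_minimum A i ((m * n)%:R * (1 + tau) / (m + n)%:R * ln T)
           < delta * T `^ ((n%:R - m%:R * tau) / (m + n)%:R)].

End Approximation.

(* Main.v *)
Require Import Defs.
From mathcomp Require Import all_boot all_order all_algebra all_field.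
From mathcomp Require Import all_classical all_reals all_analysis.
From mathcomp Require Import measurable_realfun finmap ring lra zify.

Set Implicit Arguments.
Unset Strict Implicit.
Unset Printing Implicit Defensive.

Import Order.TTheory GRing.Theory Num.Theory.
Import numFieldNormedType.Exports.

Local Open Scope classical_set_scope.
Local Open Scope ring_scope.

(** Write N(a, b) for the number of points (p, q) of Z^m x Z^n with
    |A q + p| <= a and |q| <= b, and f(t) for N at a = c e^(- tau t),
    b = c e^t, where c is a small constant. A singular b has, at every large
    time t, an approximant in the box of time t. The points of one ball of radius
    e^(- tau t) lie in at most N(e^(- tau t), e^(t + h)) / f(t + h) balls of
    radius e^(- tau (t + h)), up to a constant: each new ball is shared by
    f(t + h) lattice points. The box of sides e^(- tau t), e^(t + h) is contained
    in the dilation by e^x of the box of time t + h - x as soon as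
    (1 + tau) x >= tau h, and dilating by e^x multiplies the number of lattice
    points by at most e^(k x), where k is the rank of the points of the dilated
    box and hence at most r(e^t; delta). So one step costs
    e^(k x) f(t + h - x) / f(t + h), and averaging over the starting time makes
    the product telescope to e^((x / h) (int r dS/S - log f)), with x / h close
    to tau / (1 + tau). The constant lost in each step is harmless because h can
    be taken large, and f dominates the product of the ratios to the successive
    minima, by counting small integer combinations of nearly minimal vectors. *)

(** * Counting lattice points in boxes *)

Lemma card_fset_fibers (T : choiceType) (K : finType) (f : T -> K)
    (P : {pred K}) (X : {fset T}) (N : nat) :
  (forall x, x \in X -> f x \in P) ->
  (forall x, x \in X -> (#|` [fset y in X | f y == f x]%fset| <= N)%N) ->
  (#|` X| <= #|P| * N)%N.
Proof.
move=> fP fN; rewrite card_fset_sum1.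
rewrite big_seq_cond (partition_big f (fun k => k \in P)); last first.
  by move=> x /andP[/fP].
rewrite -sum_nat_const; apply: leq_sum => k kP.
have [[x xX fx]|noX] := pselect (exists2 x, x \in X & f x = k); last first.
  rewrite big1_seq// => x /andP[/andP[/andP[xX _] /eqP fx] _].
  by exfalso; apply: noX; exists x.
apply: leq_trans (fN x xX).
rewrite card_fset_sum1 big_fset /= [leqRHS]big_seq_cond.
rewrite fx; apply: eq_leq; apply: eq_bigl => y.
by rewrite andbT; case: (y \in X).
Qed.

Lemma card_fset_packing (V : zmodType) (Z : seq V) (Y W : {fset V}) :
  uniq Z ->
  (forall z y, z \in Z -> y \in Y -> z + y \in W) ->
  (forall z z' y y', z \in Z -> z' \in Z -> y \in Y -> y' \in Y ->
    z + y = z' + y' -> z = z') ->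
  (size Z * #|` Y| <= #|` W|)%N.
Proof.
move=> uZ ZYW inj; rewrite -(size_allpairs +%R); apply: uniq_leq_size.
  apply: allpairs_uniq; rewrite ?fset_uniq//.
  move=> _ _ /allpairsP[[z y] [/= zZ yY ->]] /allpairsP[[z' y'] [/= z'Z y'Y ->]].
  move=> e; have zz' := inj _ _ _ _ zZ z'Z yY y'Y e.
  by move: e; rewrite zz' => /addrI ->.
by move=> _ /allpairsP[[z y] [/= zZ yY ->]]; exact: ZYW.
Qed.

Section LatticeBox.
Context {R : realType} {d : nat}.
Implicit Types (g : 'M[R]_d) (w : 'I_d -> R) (x y : 'cV[int]_d).

(** Lattice points are indexed by integer columns so that they can be reduced modulo a prime. *)
Definition embed g x : 'cV[R]_d := g *m map_mx intr x.

Lemma embed0 g : embed g 0 = 0.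
Proof. by rewrite /embed map_mx0 mulmx0. Qed.

Lemma embedD g x y : embed g (x + y) = embed g x + embed g y.
Proof. by rewrite /embed map_mxD mulmxDr. Qed.

Lemma embedB g x y : embed g (x - y) = embed g x - embed g y.
Proof. by rewrite /embed map_mxB mulmxBr. Qed.

Lemma embedMn g x k : embed g (x *+ k) = embed g x *+ k.
Proof. by elim: k => [|k IH]; rewrite ?mulr0n ?embed0// !mulrS embedD IH. Qed.

Definition box g w : set 'cV[int]_d :=
  [set x | forall i, `|embed g x i ord0| <= w i].

Definition box_count g w : nat := #|` fset_set (box g w)|.

Lemma box_finite g w : g \in unitmx -> finite_set (box g w).
Proof.
move=> gu.
pose B i : R := \sum_j `|invmx g i j| * w j.
pose N := (Num.truncn (\sum_i `|B i|)).+1.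
pose f (h : {ffun 'I_d -> 'I_(N + N).+1}) : 'cV[int]_d :=
  \col_i ((h i : nat)%:Z - N%:Z).
apply: (@sub_finite_set _ _ (f @` setT)); last exact/finite_image/finite_finset.
move=> x xw.
have xB i : (`|x i ord0| <= N)%N.
  rewrite -(ler_nat R) natr_absz intr_norm.
  have -> : (x i ord0)%:~R = (invmx g *m embed g x) i ord0 :> R.
    by rewrite /embed mulmxA mulVmx// mul1mx mxE.
  rewrite mxE (le_trans (ler_norm_sum _ _ _))//.
  apply: (@le_trans _ _ (B i)).
    by apply: ler_sum => j _; rewrite normrM ler_wpM2l.
  apply: (le_trans (ler_norm _)).
  apply: (@le_trans _ _ (\sum_i `|B i|)); last first.
    by rewrite ltW// truncnS_gt.
  by rewrite (bigD1 i)//= lerDl sumr_ge0.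
exists [ffun i => inord `|x i ord0 + N%:Z|] => //.
apply/matrixP => i j; rewrite !mxE ffunE (ord1 j).
have := xB i; move: (x i ord0) => a aN.
rewrite inordK; lia.
Qed.

Lemma in_box_fset g w x : g \in unitmx -> (x \in fset_set (box g w)) = `[< box g w x >].
Proof.
by move=> gu; rewrite in_fset_set//; exact: box_finite.
Qed.

Lemma le_box_count g w w' : g \in unitmx -> (forall i, w i <= w' i) ->
  (box_count g w <= box_count g w')%N.
Proof.
move=> gu ww'; apply: fsubset_leq_card; apply/fsubsetP => x.
rewrite !in_box_fset// => /asboolP xw; apply/asboolP => i.
exact: le_trans (xw i) (ww' i).
Qed.

Lemma box_count_gt0 g w : g \in unitmx -> (forall i, 0 <= w i) ->
  (0 < box_count g w)%N.
Proof.
move=> gu w0; rewrite cardfs_gt0; apply/fset0Pn; exists 0.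
rewrite in_box_fset//; apply/asboolP => i.
by rewrite embed0 mxE normr0.
Qed.

End LatticeBox.

Lemma leq_card_fset_inj (T U : choiceType) (f : T -> U) (X : {fset T})
    (Y : {fset U}) :
  {in X &, injective f} -> (forall x, x \in X -> f x \in Y) ->
  (#|` X| <= #|` Y|)%N.
Proof.
move=> finj fXY; rewrite -(size_map f X); apply: uniq_leq_size.
  by rewrite map_inj_in_uniq// fset_uniq.
by move=> _ /mapP[x xX ->]; exact: fXY.
Qed.

Lemma floor_half_bounds (R : realType) (a w : R) (k : nat) :
  0 < w -> `|a| <= k%:R * w ->
  - (2 * k)%:Z <= Num.floor (2 * a / w) <= (2 * k)%:Z.
Proof.
move=> w0; rewrite ler_norml => /andP[a1 a2]; apply/andP; split.
  rewrite floor_ge_int ler_pdivlMr// mulrNz -[(2 * k)%N%:~R]/((2 * k)%:R : R).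
  by rewrite natrM mulNr -mulrA -mulrN ler_pM2l.
have : 2 * a / w <= (2 * k)%:R.
  by rewrite ler_pdivrMr// natrM -mulrA ler_pM2l.
by move/(le_trans (Num.Theory.floor_le _)); rewrite -[(2 * k)%:R]/((2 * k)%:Z%:~R) ler_int.
Qed.

Lemma floor_half_eq (R : realType) (a b w : R) :
  0 < w -> Num.floor (2 * a / w) = Num.floor (2 * b / w) -> `|a - b| <= w / 2.
Proof.
move=> w0 e; have := floor_itv (2 * a / w); have := floor_itv (2 * b / w).
rewrite e; move: (Num.floor (2 * b / w)) => k.
rewrite !ler_pdivlMr// !ltr_pdivrMr//= !intrD [(_ + _) * w]mulrDl mul1r.
move: (k%:~R * w) => c.
move=> /andP[b1 b2] /andP[a1 a2].
by rewrite -ler_pdivlMr// ler_norml; apply/andP; split; lra.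
Qed.

Section LatticeBox.
Context {R : realType} {d : nat}.
Implicit Types (g : 'M[R]_d) (w : 'I_d -> R) (x y : 'cV[int]_d).

(** Pigeonhole: the dilated box is cut into cells of side [w i / 2], and subtracting a fixed point
    of a cell sends the points of that cell into the half-size box. The floors take the [4 * k + 1]
    values from [- 2 * k] to [2 * k]. *)
Lemma box_count_scale g w (k : nat) : g \in unitmx -> (forall i, 0 < w i) ->
  (box_count g (fun i => k%:R * w i)%R
     <= (4 * k).+1 ^ d * box_count g (fun i => w i / 2)%R)%N.
Proof.
move=> gu w0.
pose fl x i := Num.floor (2 * embed g x i ord0 / w i).
pose cell x : {ffun 'I_d -> 'I_(4 * k).+1} :=
  [ffun i => inord `|fl x i + (2 * k)%:Z|].
have -> : ((4 * k).+1 ^ d = #|{: {ffun 'I_d -> 'I_(4 * k).+1}}|)%N.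
  by rewrite card_ffun !card_ord.
have cellE z : z \in fset_set (box g (fun i => k%:R * w i)) ->
    forall i, fl z i = (cell z i : nat)%:Z - (2 * k)%:Z.
  rewrite in_box_fset// => /asboolP zw i.
  have := floor_half_bounds (w0 i) (zw i); rewrite ffunE -/(fl z i).
  move: (fl z i) => c /andP[c1 c2].
  by rewrite inordK; lia.
apply: (@card_fset_fibers _ _ cell) => // x xkw.
apply: (@leq_card_fset_inj _ _ (fun y => y - x)); first exact: in2W (addIr _).
move=> y; rewrite !inE /= => /andP[ykw /eqP yx].
rewrite in_box_fset//; apply/asboolP => i.
rewrite embedB [X in `|X|]mxE [X in _ + X]mxE; apply: floor_half_eq => //.
by rewrite -/(fl y i) -/(fl x i) (cellE _ ykw) (cellE _ xkw) yx.
Qed.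
End LatticeBox.

Lemma free_lift (K : fieldType) (vT : vectType K) (T : eqType) (f : T -> vT)
    (s : seq T) :
  exists t : seq T, [/\ {subset t <= s}, free (map f t) &
    (<<map f t>> = <<map f s>>)%VS].
Proof.
elim: s => [|x s [t [ts ft e]]]; first by exists [::]; rewrite nil_free.
have [xt|xt] := boolP (f x \in <<map f t>>%VS).
  exists t; split => //= [y /ts ys|]; first by rewrite inE ys orbT.
  rewrite span_cons -e; apply/esym/addv_idPr.
  by rewrite -memvE.
exists (x :: t); split => /=.
- by move=> y; rewrite !inE => /orP[->//|/ts ->]; rewrite orbT.
- by rewrite free_cons xt.
- by rewrite !span_cons e.
Qed.

(** Independence over [F] gives a maximal minor that is nonzero in [F]. This minor is the image of
    an integer, which is therefore nonzero and stays nonzero in the characteristic zero field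
    [R]. *)
Lemma free_intr (F : fieldType) (R : numFieldType) (d : nat)
    (s : seq 'cV[int]_d) :
  free [seq map_mx intr x : 'cV[F]_d | x <- s] ->
  free [seq map_mx intr x : 'cV[R]_d | x <- s].
Proof.
pose k := size s; pose t : k.-tuple _ := in_tuple s.
pose G : 'M[int]_(d, k) := \matrix_(i, j) (t`_j i ord0).
have colG (K : fieldType) (a : 'I_k -> K) :
    \sum_(i < k) a i *: (map_tuple (map_mx intr) t : k.-tuple 'cV[K]_d)`_i =
    map_mx intr G *m (\col_i a i).
  apply/matrixP => r c; rewrite summxE mxE; apply: eq_bigr => i _.
  by rewrite (nth_map 0) ?size_tuple// !mxE mulrC (ord1 c).
move=> /(@freeP F _ k (map_tuple (map_mx intr) t)) sF.
have full : row_full (map_mx intr G : 'M[F]_(d, k)).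
  rewrite /row_full -mxrank_tr; apply: inj_row_free => v.
  move=> /(congr1 trmx); rewrite trmx_mul trmxK trmx0 => v0.
  apply/rowP => i; rewrite mxE; apply: (sF (v ord0)).
  by rewrite colG -[RHS]v0; congr (_ *m _); apply/colP => j; rewrite !mxE.
apply/(@freeP R _ k (map_tuple (map_mx intr) t)) => a; rewrite colG => a0 i.
have := fullrowsub_unit full; set f := fullrankfun full.
rewrite -map_mxsub unitmxE det_map_mx unitfE => detF.
have detR : rowsub f (map_mx intr G : 'M[R]_(d, k)) \in unitmx.
  rewrite -map_mxsub unitmxE det_map_mx unitfE intr_eq0.
  by apply: contraNneq detF => ->.
have : rowsub f (map_mx intr G) *m (\col_i a i) = 0.
  by rewrite mul_rowsub_mx a0; apply/matrixP => r c; rewrite !mxE.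
move=> /(congr1 (mulmx (invmx (rowsub f (map_mx intr G))))).
by rewrite mulKmx// mulmx0 => /colP /(_ i); rewrite !mxE.
Qed.

Lemma free_mulmx (K : fieldType) (d : nat) (g : 'M[K]_d) (s : seq 'cV[K]_d) :
  g \in unitmx -> free s -> free [seq g *m v | v <- s].
Proof.
move=> gu; pose k := size s; pose t : k.-tuple _ := in_tuple s.
move=> /(@freeP K _ k t) sF.
apply/(@freeP K _ k (map_tuple (mulmx g) t)) => a a0; apply: sF.
have : g *m (\sum_(i < k) a i *: t`_i) = 0.
  rewrite mulmx_sumr -[RHS]a0; apply: eq_bigr => i _.
  by rewrite -scalemxAr (nth_map 0) ?size_tuple.
by move=> /(congr1 (mulmx (invmx g))); rewrite mulKmx// mulmx0.
Qed.

Section PrimeDilation.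
Context {R : realType} {d : nat}.
Implicit Types (g : 'M[R]_d) (w : 'I_d -> R) (x y : 'cV[int]_d).

(* The residues mod p of the points of the dilated box span a subspace over F_p
   whose dimension is at most the real rank, as a minor that is nonzero mod p is
   nonzero; two points with the same residue differ by p times a lattice point
   of the box of double size. *)
Lemma box_count_prime g w (p : nat) : g \in unitmx -> prime p ->
  exists s : seq 'cV[int]_d,
    [/\ free [seq embed g x | x <- s],
        forall x, x \in s -> box g (fun i => p%:R * w i) x &
        (box_count g (fun i => p%:R * w i)%R
           <= p ^ size s * box_count g (fun i => 2 * w i)%R)%N].
Proof.
move=> gu pp; have p0 : (0 < p)%N := prime_gt0 pp.
pose red x : 'cV['F_p]_d := map_mx intr x.
pose X := fset_set (box g (fun i => p%:R * w i)).
have [t [tX tf te]] := free_lift red X.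
have redP x y : red y = red x -> {z | y - x = z *+ p}.
  move=> e; exists (map_mx (fun a => (a %/ p%:Z)%Z) (y - x)).
  apply/matrixP => i j; rewrite mulmxnE [X in X *+ _]mxE -mulr_natr natz.
  rewrite divzK ?mxE// (dvdz_pcharf (pchar_Fp pp)).
  move/matrixP: e => /(_ i j); rewrite !mxE intrD intrN => ->.
  by rewrite subrr.
exists t; split.
- rewrite (_ : [seq _ | _ <- _] =
    [seq g *m v | v <- [seq (map_mx intr x : 'cV[R]_d) | x <- t]]).
    by apply: free_mulmx => //; exact: free_intr tf.
  by rewrite -map_comp.
- by move=> x /tX; rewrite in_box_fset// => /asboolP.
have -> : (p ^ size t = #|<<map red X>>%VS|)%N.
  rewrite card_vspace card_Fp// -te; congr (_ ^ _)%N.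
  by move: tf; rewrite /free => /eqP ->; rewrite size_map.
apply: (@card_fset_fibers _ _ red) => [x xX|x xX].
  exact/memv_span/map_f.
(* The quotient of [y - x] by [p], with the default value 0 off the residue class of [x]. *)
pose dv y : 'cV[int]_d := if pselect (red y = red x) is left e
  then sval (redP x y e) else 0.
have dvP y : red y = red x -> y - x = dv y *+ p.
  by rewrite /dv; case: pselect => // e _; exact: proj2_sig (redP x y e).
apply: (@leq_card_fset_inj _ _ dv) => [y y' /=|y].
  rewrite !inE /= => /andP[_ /eqP yx] /andP[_ /eqP y'x] e.
  by apply: (addIr (- x)); rewrite dvP// e dvP.
rewrite !inE /= => /andP[yX /eqP yx]; move: xX yX; rewrite !in_box_fset//.
move=> /asboolP xw /asboolP yw; apply/asboolP => i.
have pR : 0 < p%:R :> R by rewrite ltr0n.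
rewrite -(ler_pM2l pR) -[X in X * `|_|]gtr0_norm// -normrM.
have -> : p%:R * embed g (dv y) i ord0 = embed g y i ord0 - embed g x i ord0.
  rewrite mulr_natl -mulmxnE -embedMn -dvP// embedB.
  by rewrite [LHS]mxE [X in _ + X]mxE.
rewrite (le_trans (ler_normB _ _))// mulrCA mulr_natl mulr2n.
exact: lerD (yw i) (xw i).
Qed.
End PrimeDilation.

(** * Successive minima *)

Section SuccessiveMinima.
Context {R : realType} {d : nat}.
Variable g : 'M[R]_d.
Hypothesis gu : g \in unitmx.
Implicit Types (x y : 'cV[int]_d).

Lemma int_vectorP (v : 'cV[R]_d) :
  int_vector v <-> exists x : 'cV[int]_d, v = map_mx intr x.
Proof.
split => [/mxOverP vint|[x ->]].
  exists (map_mx Num.floor v); apply/matrixP => i j.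
  by rewrite !mxE; apply/esym/eqP; rewrite -intrEfloor.
by apply/mxOverP => i j; rewrite mxE intr_int.
Qed.

Let L : set 'cV[R]_d := [set g *m v | v in [set v | int_vector v]].

Let LP v : L v <-> exists x, v = embed g x.
Proof.
split => [[_ /int_vectorP[x ->] <-]|[x ->]]; first by exists x.
by exists (map_mx intr x) => //; apply/int_vectorP; exists x.
Qed.

Let cubeP (l : R) (v : 'cV[R]_d) : 0 < l ->
  [set l *: w | w in unit_cube] v <-> forall i, `|v i ord0| <= l.
Proof.
move=> l0; split => [[w w1 <-] i|vl].
  rewrite mxE normrM gtr0_norm//; apply: ler_piMr; first exact: ltW.
  by rewrite ler_norml; exact: w1.
exists (l^-1 *: v); last by rewrite scalerA divff ?gt_eqF// scale1r.
move=> i; rewrite mxE -ler_norml normrM gtr0_norm ?invr_gt0//.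
by rewrite ler_pdivrMl// mulr1.
Qed.

Let minimum_set (i : nat) := [set l : R | 0 < l /\
    exists s : i.-tuple 'cV[R]_d,
      free s /\
      forall v, v \in s -> ([set l *: w | w in unit_cube] `&` L) v].

(** Some coordinate of [x] has absolute value at least 1, and the inverse matrix bounds it by a
    multiple of [l]. This keeps the successive minima away from 0. *)
Lemma embed_gap : exists2 e : R, 0 < e &
  forall x l, x != 0 -> (forall i, `|embed g x i ord0| <= l) -> e <= l.
Proof.
pose C := 1 + \sum_i \sum_j `|invmx g i j|.
have C0 : 0 < C by rewrite ltr_pwDl// sumr_ge0// => i _; rewrite sumr_ge0.
exists C^-1; first by rewrite invr_gt0.
move=> x l x0 xl.
have [i xi0] : exists i, x i ord0 != 0.
  apply: contrapT => /forallNP xi; move/negP: x0; apply.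
  by apply/eqP/colP => i; rewrite mxE; apply/eqP/negPn/negP; exact: xi.
have l0 : 0 <= l by rewrite (le_trans _ (xl i)).
have : `|x i ord0|%:~R <= C * l.
  have -> : `|x i ord0|%:~R = `|(invmx g *m embed g x) i ord0| :> R.
    by rewrite /embed mulmxA mulVmx// mul1mx mxE intr_norm.
  rewrite mxE (le_trans (ler_norm_sum _ _ _))//.
  apply: (@le_trans _ _ ((\sum_j `|invmx g i j|) * l)).
    by rewrite mulr_suml; apply: ler_sum => j _; rewrite normrM ler_wpM2l.
  rewrite ler_wpM2r// [X in _ <= 1 + X](bigD1 i)//= addrCA lerDl.
  rewrite addr_ge0// sumr_ge0// => j _.
  by rewrite sumr_ge0.
rewrite -[C^-1]mulr1 ler_pdivrMl//; apply: le_trans.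
by rewrite ler1z -gtz0_ge1 normr_gt0.
Qed.

(** The columns of [g] provide the vectors. As [inf] of the empty set is 0, a positive lower bound
    on a minimum rests on this. *)
Lemma minimum_set_neq0 (i : nat) : (i <= d)%N -> minimum_set i !=set0.
Proof.
move=> id.
pose b : d.-tuple 'cV[R]_d := [tuple delta_mx j ord0 | j < d].
have bfree : free b.
  apply/freeP => a; rewrite (eq_bigr (fun j => a j *: delta_mx j ord0)); last first.
    by move=> j _; rewrite -tnth_nth tnth_mktuple.
  move=> /colP a0 j; have := a0 j; rewrite summxE (bigD1 j)//= big1; last first.
    by move=> k /negPf kj; rewrite !mxE eq_sym kj mulr0.
  by rewrite !mxE !eqxx mulr1 addr0.
pose s := [seq g *m v | v <- take i b].
have ss : size s == i by rewrite size_map size_takel// size_tuple.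
pose l := 1 + \sum_(v <- s) \sum_k `|v k ord0|.
have l0 : 0 < l.
  by rewrite ltr_pwDl// sumr_ge0// => v _; rewrite sumr_ge0.
exists l; split => //; exists (Tuple ss); split => /=.
  apply: free_mulmx => //; move: bfree; rewrite -{1}(cat_take_drop i b).
  exact: catl_free.
move=> v vs; split.
  apply/cubeP => // k; apply: (@le_trans _ _ (\sum_k `|v k ord0|)).
    by rewrite (bigD1 k)//= lerDl sumr_ge0.
  rewrite /l (big_rem v)//= addrCA lerDl addr_ge0// sumr_ge0// => u _.
  by rewrite sumr_ge0.
move: vs => /mapP[_ /mem_take /mapP[j _ ->] ->]; apply/LP.
exists (delta_mx j ord0); rewrite /embed; congr (_ *m _).
by apply/matrixP => a c; rewrite !mxE; case: (_ && _).
Qed.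

Lemma successive_minimum_gt0 (i : nat) : (0 < i <= d)%N -> 0 < successive_minimum L i.
Proof.
move=> /andP[i0 id]; have [e e0 eP] := embed_gap.
apply: (lt_le_trans e0); apply: lb_le_inf; first exact: minimum_set_neq0.
move=> l [l0 [s [sf sP]]].
have s0 : (0 < size s)%N by rewrite size_tuple.
have vs := mem_nth 0 s0; have [/cubeP vl /LP[x vx]] := sP _ vs.
apply: (eP x) => [|k].
  by apply: contraNneq (free_not0 sf vs) => x0; rewrite vx x0 embed0.
by rewrite -vx; exact: vl.
Qed.

Lemma successive_minimum_le (i : nat) l (s : i.-tuple 'cV[int]_d) : 0 < l ->
  free [seq embed g x | x <- s] ->
  (forall x, x \in s -> forall k, `|embed g x k ord0| <= l) ->
  successive_minimum L i <= l.
Proof.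
move=> l0 sf sl; apply: ge_inf; first by exists 0 => u [/ltW].
split => //; exists (map_tuple (embed g) s); split => //.
move=> _ /mapP[x xs ->]; split; last by apply/LP; exists x.
by apply/cubeP => //; exact: sl.
Qed.

(** Induction: among [k.+1] independent vectors nearly realising the next minimum, one lies outside
    the span of the [k] vectors already chosen. The factor 2 stands in for attainment of the
    infimum. *)
Lemma near_minimal_vectors (k : nat) : (k <= d)%N ->
  exists t : seq 'cV[int]_d, [/\ size t = k, free [seq embed g x | x <- t] &
    forall i, (i < k)%N -> forall r,
      `|embed g t`_i r ord0| <= 2 * successive_minimum L i.+1].
Proof.
elim: k => [|k IH] kd; first by exists [::]; split => //; rewrite nil_free.
have [t [tk tf tl]] := IH (ltnW kd).
have lam0 : 0 < successive_minimum L k.+1 by exact: successive_minimum_gt0.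
have [|l [l0 [s [sf sP]]] lle] := @inf_adherent _ (minimum_set k.+1) _ lam0.
  by split; [exact: minimum_set_neq0|exists 0 => u [/ltW]].
have [v vs vt] : exists2 v, v \in s & v \notin <<[seq embed g x | x <- t]>>%VS.
  apply: contrapT => H.
  have : (span s <= span [seq embed g x | x <- t])%VS.
    apply/span_subvP => v vs; apply: contrapT => /negP vt.
    by apply: H; exists v.
  move=> /dimvS; apply/negP; rewrite -ltnNge.
  move: sf tf; rewrite /free => /eqP -> /eqP ->.
  by rewrite size_map size_tuple tk.
have [/cubeP vl /LP[x vx]] := sP _ vs.
exists (rcons t x); split; first by rewrite size_rcons tk.
  rewrite map_rcons -cats1 (perm_free (permEl (perm_catC _ _)))/= free_cons.
  by rewrite -vx vt.
move=> i; rewrite ltnS leq_eqVlt => /orP[/eqP ->|ik] r.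
  rewrite nth_rcons tk ltnn eqxx -vx (le_trans (vl l0 r))// ltW//.
  by rewrite (lt_le_trans lle)// mulr_natl mulr2n.
by rewrite nth_rcons tk ik; exact: tl.
Qed.
End SuccessiveMinima.

(* Counts the combinations of the near-minimal vectors v_i with natural
   coefficients at most rho / (2 d lambda_i). *)
Lemma prod_minima_le (R : realType) (d : nat) (g : 'M[R]_d) (rho : R) :
  g \in unitmx -> 0 < rho ->
  \prod_(1 <= i < d.+1) Num.max
     (rho / successive_minimum [set g *m v | v in [set v | int_vector v]] i) 1
  <= (2 * d)%:R ^+ d * (box_count g (fun=> rho))%:R.
Proof.
move=> gu rho0; set lam := successive_minimum _.
have [t [td tf tl]] := near_minimal_vectors gu (leqnn d).
have lam0 (i : 'I_d) : 0 < lam i.+1 by apply: successive_minimum_gt0 => //=; exact: ltn_ord.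
pose N (i : 'I_d) := Num.truncn (rho / ((2 * d)%:R * lam i.+1)).
have d0 (i : 'I_d) : 0 < (2 * d)%:R :> R.
  by rewrite ltr0n muln_gt0/= (leq_ltn_trans (leq0n i) (ltn_ord i)).
pose pt (h : {dffun forall i : 'I_d, 'I_(N i).+1}) : 'cV[int]_d :=
  \sum_(i < d) t`_i *+ h i.
have ptE h : embed g (pt h) = \sum_(i < d) embed g t`_i *+ h i.
  rewrite (big_morph _ (embedD g) (embed0 g)).
  by apply: eq_bigr => i _; exact: embedMn.
have pt_inj : injective pt.
  move=> h h' /(congr1 (embed g)); rewrite !ptE => /eqP.
  rewrite -subr_eq0 -sumrB => /eqP e.
  have ts : size t == d by rewrite td.
  have /(@freeP _ _ d (map_tuple (embed g) (Tuple ts))) fr := tf.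
  apply/ffunP => i; apply: val_inj => /=.
  have := fr (fun i => (h i)%:R - (h' i)%:R) _ i; rewrite -[RHS]e => H.
  apply/eqP; rewrite -(eqr_nat R) -subr_eq0; apply/eqP; apply: H.
  apply: eq_bigr => j _; rewrite (nth_map 0) ?td//= scalerBl !scaler_nat.
  by [].
have pt_box h : pt h \in fset_set (box g (fun=> rho)).
  rewrite in_box_fset//; apply/asboolP => r; rewrite ptE summxE.
  apply: (le_trans (ler_norm_sum _ _ _)).
  (* The bound [2 * lam i.+1] on a vector, times the bound on its coefficient, leaves a share
     [rho / d] for each of the [d] vectors. *)
  apply: (@le_trans _ _ (\sum_(i < d) rho / d%:R)).
    apply: ler_sum => i _; rewrite mulmxnE normrMn -[leLHS]mulr_natr.
    apply: (@le_trans _ _ (2 * lam i.+1 * (rho / ((2 * d)%:R * lam i.+1)))).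
      apply: ler_pM => //; first exact: tl.
      apply: (@le_trans _ _ (N i)%:R); first by rewrite ler_nat -ltnS.
      by rewrite truncn_le divr_ge0 ?mulr_ge0// ltW.
    rewrite natrM le_eqVlt; apply/orP; left; apply/eqP.
    have l0 := lt0r_neq0 (lam0 i).
    have dn : d%:R != 0 :> R.
      by rewrite pnatr_eq0 -lt0n (leq_ltn_trans (leq0n i) (ltn_ord i)).
    by field; rewrite ?l0 ?dn.
  rewrite sumr_const card_ord -[_ *+ d]mulr_natr.
  have [->|dn] := eqVneq d 0%N; first by rewrite mulr0 ltW.
  by rewrite divfK// pnatr_eq0.
have cnt : (\prod_(i < d) (N i).+1 <= box_count g (fun=> rho))%N.
  have -> : (\prod_(i < d) (N i).+1 =
      #|{: {dffun forall i : 'I_d, 'I_(N i).+1}}|)%N.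
    rewrite card_dep_ffun foldrE big_image /=.
    by apply: eq_bigr => i _; rewrite card_ord.
  rewrite cardE -(size_map pt); apply: uniq_leq_size.
    by rewrite map_inj_uniq// enum_uniq.
  by move=> _ /mapP[h _ ->]; exact: pt_box.
rewrite big_add1 big_mkord /=.
apply: (@le_trans _ _ (\prod_(i < d) ((2 * d)%:R * (N i).+1%:R))).
  apply: ler_prod => i _; apply/andP; split; first by rewrite le_max ler01 orbT.
  rewrite ge_max; apply/andP; split.
    have -> : rho / lam i.+1 = (2 * d)%:R * (rho / ((2 * d)%:R * lam i.+1)).
      by rewrite invfM mulrCA mulVKf// gt_eqF// d0.
    by apply: ler_wpM2l; rewrite ltW ?d0 ?truncnS_gt.
  by apply: mulr_ege1; rewrite ler1n// -(ltr0n R); exact: d0 i.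
rewrite big_split /= prodr_const card_ord -natr_prod.
by apply: ler_wpM2l; rewrite ?exprn_ge0// ler_nat.
Qed.

(** * The flow *)

Section Flow.
Context {R : realType} {m n : nat}.
Variable A : 'M[R]_(m, n).
Hypotheses (hm : (0 < m)%N) (hn : (0 < n)%N).

Definition side (a b : R) (i : 'I_(m + n)) : R := if (i < m)%N then a else b.

Lemma side_lshift a b i : side a b (lshift n i) = a.
Proof. by rewrite /side /= ltn_ord. Qed.

Lemma side_rshift a b i : side a b (rshift m i) = b.
Proof. by rewrite /side /= ltnNge leq_addr. Qed.

Lemma side_gt0 a b i : 0 < a -> 0 < b -> 0 < side a b i.
Proof. by rewrite /side; case: ifP. Qed.

Lemma le_side a b a' b' i : a <= a' -> b <= b' -> side a b i <= side a' b' i.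
Proof. by rewrite /side; case: ifP. Qed.

Lemma side_scale c a b : (fun i => c * side a b i) = side (c * a) (c * b).
Proof. by apply/funext => i; rewrite /side; case: ifP. Qed.

Lemma norm_side_scale c c' a b i (y : R) : 0 < c -> 0 < c' ->
  (`|side c c' i * y| <= side (c * a) (c' * b) i) = (`|y| <= side a b i).
Proof.
by move=> c0 c'0; rewrite normrM /side; case: ifP => _;
  rewrite gtr0_norm// ler_pM2l.
Qed.

Lemma unipotent_unit : unipotent_mx A \in unitmx.
Proof. by rewrite unitmxE det_ublock !det1 mulr1 unitr1. Qed.

Lemma flow_unit t : @diagonal_flow R m n t *m unipotent_mx A \in unitmx.
Proof.
rewrite unitmx_mul unipotent_unit andbT unitmxE det_ublock !det_scalar.
by rewrite unitfE mulf_neq0// expf_neq0// gt_eqF// expR_gt0.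
Qed.

Lemma flow_latticeE t : flow_lattice A t =
  [set (diagonal_flow t *m unipotent_mx A) *m v | v in [set v | int_vector v]].
Proof. by []. Qed.

Lemma embed_flow t x i :
  embed (diagonal_flow t *m unipotent_mx A) x i ord0 =
  side (expR (t / m%:R)) (expR (- t / n%:R)) i * embed (unipotent_mx A) x i ord0.
Proof.
rewrite /embed -mulmxA; move: (_ *m map_mx _ _) => v.
rewrite -{1}[v]vsubmxK mul_block_col !mul_scalar_mx !mul0mx addr0 add0r.
have [j ->|j ->] := split_ordP i.
  by rewrite side_lshift col_mxEu [LHS]mxE [usubmx v _ _]mxE.
by rewrite side_rshift col_mxEd [LHS]mxE [dsubmx v _ _]mxE.
Qed.

(** The flow is diagonal and only rescales the sides, so all counts can be made in the single
    lattice of [unipotent_mx A]. *)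
Lemma box_flow t a b :
  box (diagonal_flow t *m unipotent_mx A)
    (side (expR (t / m%:R) * a) (expR (- t / n%:R) * b)) =
  box (unipotent_mx A) (side a b).
Proof.
by apply/seteqP; split => x xb i; have := xb i;
  rewrite embed_flow norm_side_scale ?expR_gt0.
Qed.

Let mR : m%:R != 0 :> R. Proof. by rewrite pnatr_eq0 -lt0n. Qed.
Let nR : n%:R != 0 :> R. Proof. by rewrite pnatr_eq0 -lt0n. Qed.
Let mnR : m%:R + n%:R != 0 :> R.
Proof. by rewrite -natrD pnatr_eq0 -lt0n addn_gt0 hm. Qed.

(** At time [flow_time r q] the flow turns the box of sides [r], [q] into the cube of half-side
    [rho], to which [prod_minima_le] applies. *)
Lemma covering_product_le r q : 0 < r -> 0 < q ->
  covering_product A r q <=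
    (2 * (m + n))%:R ^+ (m + n) * (box_count (unipotent_mx A) (side r q))%:R.
Proof.
move=> r0 q0; set rho := q `^ (n%:R / (m + n)%:R) * r `^ (m%:R / (m + n)%:R).
have rho0 : 0 < rho by rewrite mulr_gt0// powR_gt0.
set t := @flow_time R m n r q.
suff E : box_count (diagonal_flow t *m unipotent_mx A)
  (fun=> rho) = box_count (unipotent_mx A) (side r q).
  have := prod_minima_le (flow_unit t) rho0; rewrite E.
  by rewrite /covering_product /flow_minimum flow_latticeE -/rho.
rewrite /box_count -(box_flow t); congr (#|` fset_set (box _ _)|).
have rhoE : rho = expR (ln q * (n%:R / (m + n)%:R) + ln r * (m%:R / (m + n)%:R)).
  by rewrite /rho /powR !gt_eqF// expRD ![_ * ln _]mulrC.
have -> : expR (t / m%:R) * r = rho.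
  rewrite -{1}[r]lnK ?posrE// -expRD rhoE; congr expR.
  by rewrite /t /flow_time ln_div ?posrE// natrM natrD; field; rewrite mR mnR.
have -> : expR (- t / n%:R) * q = rho.
  rewrite -{1}[q]lnK ?posrE// -expRD rhoE; congr expR.
  by rewrite /t /flow_time ln_div ?posrE// natrM natrD; field; rewrite nR mnR.
by apply/funext => i; rewrite /side; case: ifP.
Qed.

(** At the time attached to [S], the box of sides [e * S ^ (- tau)], [e * S] becomes the cube of
    half-side [e * rho]. The first [i] vectors of [s] thus make the [i]-th minimum at most
    [e * rho], strictly below [delta * rho]. *)
Lemma small_minima_count_ge tau S delta e a b (s : seq 'cV[int]_(m + n)) :
  0 < S -> 0 < e < delta -> a <= e * S `^ (- tau) -> b <= e * S ->
  free [seq embed (unipotent_mx A) x | x <- s] ->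
  (forall x, x \in s -> box (unipotent_mx A) (side a b) x) ->
  (size s <= small_minima_count A tau S delta)%N.
Proof.
move=> S0 /andP[e0 ed] ae be sf sb.
set t := (m * n)%:R * (1 + tau) / (m + n)%:R * ln S.
set rho := S `^ ((n%:R - m%:R * tau) / (m + n)%:R).
have rho0 : 0 < rho by rewrite powR_gt0.
have bnd x : x \in s -> forall k,
    `|embed (diagonal_flow t *m unipotent_mx A) x k ord0| <= e * rho.
  move=> /sb xb.
  have {}xb : box (unipotent_mx A) (side (e * S `^ (- tau)) (e * S)) x.
    by move=> k; apply: (le_trans (xb k)); exact: le_side.
  move: xb; rewrite -(box_flow t) => xb k; apply: (le_trans (xb k)).
  rewrite mulrCA [X in side _ X]mulrCA.
  have -> : expR (t / m%:R) * S `^ (- tau) = rho.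
    rewrite /rho /powR gt_eqF// -expRD; congr expR.
    by rewrite /t natrM natrD; field; rewrite mR mnR.
  have -> : expR (- t / n%:R) * S = rho.
    rewrite -{1}[S]lnK ?posrE// /rho /powR gt_eqF// -expRD; congr expR.
    by rewrite /t natrM natrD; field; rewrite nR mnR.
  by rewrite /side; case: ifP.
have sd : (size s <= m + n)%N.
  have := sf; rewrite /free size_map => /eqP <-.
  rewrite (leq_trans (dimvS (subvf _)))//.
  by rewrite dimvf /dim /= muln1.
rewrite /small_minima_count [X in iota 1 X](esym (subnKC sd)) iotaD filter_cat size_cat.
apply: leq_trans (leq_addr _ _).
rewrite -[leqLHS](size_iota 1).
rewrite (_ : [seq i <- _ | _] = iota 1 (size s))//.
apply/all_filterP/allP => i; rewrite mem_iota add1n ltnS => /andP[i1 ile].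
have ts : size (take i s) == i by rewrite size_takel.
rewrite -/t -/rho /flow_minimum flow_latticeE.
apply: (@le_lt_trans _ _ (e * rho)); last by rewrite ltr_pM2r.
apply: (@successive_minimum_le _ _ _ _ _ (Tuple ts)) => /=.
- by rewrite mulr_gt0.
- rewrite (_ : [seq _ | _ <- _] = [seq diagonal_flow t *m v |
      v <- [seq embed (unipotent_mx A) x | x <- take i s]]).
    apply: free_mulmx; first by have := flow_unit t; rewrite unitmx_mul => /andP[].
    by move: sf; rewrite -{1}(cat_take_drop i s) map_cat; exact: catl_free.
  by rewrite -map_comp; apply: eq_map => x /=; rewrite /embed mulmxA.
- by move=> x /mem_take; exact: bnd.
Qed.

End Flow.

(** * Covering *)

Lemma separated_net (T : eqType) (close : rel T) (s : seq T) :
  symmetric close -> reflexive close ->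
  exists t : seq T, [/\ {subset t <= s}, uniq t,
    forall y y', y \in t -> y' \in t -> close y y' -> y = y' &
    forall x, x \in s -> exists2 y, y \in t & close x y].
Proof.
move=> csym crefl; elim: s => [|x s [t [ts ut sep net]]]; first by exists [::].
have [/hasP[y yt xy]|xt] := boolP (has (close x) t).
  exists t; split => //; first by move=> z /ts zs; rewrite inE zs orbT.
  by move=> z; rewrite inE => /predU1P[->|/net//]; exists y.
exists (x :: t); split => /=.
- by move=> z; rewrite !inE => /predU1P[->|/ts ->]; rewrite ?eqxx ?orbT.
- rewrite ut andbT; apply: contra xt => xt; apply/hasP; exists x; rewrite ?xt ?crefl//.
- have far y : y \in t -> ~ close x y.
    by move=> yt xy; move/hasP: xt; apply; exists y.
  move=> y y'; rewrite !inE => /predU1P[->|yt] /predU1P[->|y't]//.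
  + by move/(far _ y't).
  + by rewrite csym => /(far _ yt).
  + exact: sep.
- move=> z; rewrite inE => /predU1P[->|/net[y yt zy]].
    by exists x; [rewrite inE eqxx|exact: crefl].
  by exists y => //; rewrite inE yt orbT.
Qed.

Section Covering.
Context {R : realType} {m n : nat}.
Variable A : 'M[R]_(m, n).
Implicit Types (x : torus R m) (y z : 'cV[int]_(m + n)) (a b : R).

Let U := unipotent_mx A.

(** For [z = (p, q)], [upper] and [lower] are the coordinates of [A q + p] and of [q]. *)
Definition upper z (i : 'I_m) : R := embed U z (lshift n i) ord0.
Definition lower z (j : 'I_n) : R := embed U z (rshift m j) ord0.

Lemma upperD y z i : upper (y + z) i = upper y i + upper z i.
Proof. by rewrite /upper embedD mxE. Qed.

Lemma upperB y z i : upper (y - z) i = upper y i - upper z i.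
Proof. by rewrite /upper embedB [LHS]mxE [X in _ + X]mxE. Qed.

Lemma lowerD y z i : lower (y + z) i = lower y i + lower z i.
Proof. by rewrite /lower embedD mxE. Qed.

Lemma lowerB y z i : lower (y - z) i = lower y i - lower z i.
Proof. by rewrite /lower embedB [LHS]mxE [X in _ + X]mxE. Qed.

Lemma embed_col_mx (p : 'cV[int]_m) (q : 'cV[int]_n) :
  embed U (col_mx p q) =
  col_mx (map_mx intr p + A *m map_mx intr q) (map_mx intr q).
Proof.
by rewrite /embed map_col_mx mul_block_col !mul1mx mul0mx add0r.
Qed.

Lemma upper_col0 (p : 'cV[int]_m) i : upper (col_mx p 0) i = (p i ord0)%:~R.
Proof.
by rewrite /upper embed_col_mx col_mxEu map_mx0 mulmx0 addr0 mxE.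
Qed.

Lemma lower_col0 (p : 'cV[int]_m) j : lower (col_mx p 0) j = 0.
Proof. by rewrite /lower embed_col_mx col_mxEd map_mx0 mxE. Qed.

Lemma box_sideP a b z : box U (side a b) z <->
  (forall i, `|upper z i| <= a) /\ (forall j, `|lower z j| <= b).
Proof.
split => [H|[H1 H2] k].
  by split => i; [have := H (lshift n i); rewrite side_lshift|
                  have := H (rshift m i); rewrite side_rshift].
have [i ->|j ->] := split_ordP k; first by rewrite side_lshift; exact: H1.
by rewrite side_rshift; exact: H2.
Qed.

Definition approximable a b : set (torus R m) :=
  [set x | exists z, (forall i, `|upper z i - torus_lift x i ord0| <= a) /\
                     (forall j, `|lower z j| <= b)].

(** The projection to the torus of the cube of half-side [a] around [upper z]; the integer vector
    [p] absorbs the choice made by [torus_lift]. *)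
Definition cell z a : set (torus R m) :=
  [set x | exists p : 'cV[int]_m,
     forall i, `|upper z i + (p i ord0)%:~R - torus_lift x i ord0| <= a].

(* A maximal separated set of differences of approximants gives the new centres;
   their translates of the half-size box are disjoint, which bounds their number
   by a quotient of counts. *)
Lemma refine_cell (E : set (torus R m)) a b a' b' z :
  0 < a' <= a -> 0 < b <= b' ->
  E `<=` approximable a' b' -> (forall j, `|lower z j| <= b) ->
  E `<=` cell z (2 * a) ->
  exists C : seq 'cV[int]_(m + n),
    [/\ forall y, y \in C -> forall j, `|lower y j| <= b',
        forall x, E x -> exists2 y, y \in C & cell y (2 * a') x &
        (size C * box_count U (side (a' / 2) (b' / 2))
           <= box_count U (side (4 * a) (4 * b')))%N].
Proof.
move=> /andP[a'0 a'a] /andP[b0 bb'] Eapp zb Ez.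
have Uu : U \in unitmx by exact: unipotent_unit.
(* A displacement [y] is good for [x] when it leads from the old centre [z] to an approximant of
   [x], up to an integer translation. *)
pose good y x := (forall j, `|lower (z + y) j| <= b') /\
  exists p : 'cV[int]_m,
    forall i, `|upper (z + y) i + (p i ord0)%:~R - torus_lift x i ord0| <= a'.
(* [3 * a] is the radius [2 * a] of the old cell plus the error [a' <= a]; [2 * b'] bounds
   [b + b']. *)
pose B := fset_set (box U (side (3 * a) (2 * b'))).
have Egood x : E x -> exists2 y, y \in B & good y x.
  move=> Ex; have [p pz] := Ez _ Ex; have [z' [z'a z'b]] := Eapp _ Ex.
  exists (z' - z - col_mx p 0).
    rewrite in_box_fset//; apply/asboolP/box_sideP; split => [i|j].
      rewrite !upperB upper_col0.
      have := pz i; have := z'a i; rewrite !ler_norml => /andP[? ?] /andP[? ?].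
      by apply/andP; split; lra.
    rewrite !lowerB lower_col0 subr0.
    have := z'b j; have := zb j; rewrite !ler_norml => /andP[? ?] /andP[? ?].
    by apply/andP; split; lra.
  split => [j|].
    by rewrite lowerD !lowerB lower_col0 subr0 subrKC; exact: z'b.
  exists p => i; rewrite upperD !upperB upper_col0.
  have := z'a i; set u := upper z' i; set v := upper z i => H.
  by rewrite (_ : _ - _ = u - torus_lift x i ord0)//; ring.
(* Only upper coordinates are compared, since they alone determine the position of a cell in the
   torus. *)
pose close y y' := [forall i, `|upper (y - y') i| <= a'].
have csym : symmetric close.
  by move=> y y'; apply: eq_forallb => i; rewrite !upperB distrC.
have crefl : reflexive close.
  by move=> y; apply/forallP => i; rewrite upperB subrr normr0 ltW.
pose Y := [seq y <- B | `[< exists2 x, E x & good y x >]].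
have [Z [ZY uZ sep net]] := separated_net Y csym crefl.
have ZB y : y \in Z -> y \in B by move/ZY; rewrite mem_filter => /andP[].
exists [seq z + y | y <- Z]; split.
- move=> _ /mapP[y /ZY + ->]; rewrite mem_filter => /andP[/asboolP[x _ [yb _]] _].
  exact: yb.
- move=> x Ex; have [y yB yx] := Egood x Ex.
  have [|y1 y1Z /forallP cl] := net y.
    by rewrite mem_filter yB andbT; apply/asboolP; exists x.
  exists (z + y1); first exact: map_f.
  have [_ [p py]] := yx; exists p => i.
  have := py i; have := cl i; rewrite upperB !upperD.
  rewrite !ler_norml => /andP[? ?] /andP[? ?].
  by apply/andP; split; lra.
(* The translates fit in the large box because [3 * a + a' / 2 <= 4 * a] and
   [2 * b' + b' / 2 <= 4 * b']. *)
rewrite size_map; apply: card_fset_packing => // [y w yZ|y y' w w' yZ y'Z].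
  have := ZB _ yZ; rewrite !in_box_fset// => /asboolP/box_sideP[y1 y2].
  move=> /asboolP/box_sideP[w1 w2]; apply/asboolP/box_sideP; split => [i|j].
    rewrite upperD; have := y1 i; have := w1 i.
    rewrite !ler_norml => /andP[? ?] /andP[? ?].
    by apply/andP; split; lra.
  rewrite lowerD; have := y2 j; have := w2 j.
  rewrite !ler_norml => /andP[? ?] /andP[? ?].
  by apply/andP; split; lra.
rewrite !in_box_fset// => /asboolP/box_sideP[w1 _] /asboolP/box_sideP[w1' _] e.
apply: sep => //; apply/forallP => i.
have -> : y - y' = w' - w.
  by apply/eqP; rewrite subr_eq addrAC eq_sym subr_eq addrC e addrC.
rewrite upperB; have := w1 i; have := w1' i.
rewrite !ler_norml => /andP[? ?] /andP[? ?].
by apply/andP; split; lra.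
Qed.

Lemma refine_cover (E : set (torus R m)) a b a' b' (C : seq 'cV[int]_(m + n)) :
  0 < a' <= a -> 0 < b <= b' -> E `<=` approximable a' b' ->
  (forall z, z \in C -> forall j, `|lower z j| <= b) ->
  (forall x, E x -> exists2 z, z \in C & cell z (2 * a) x) ->
  exists C' : seq 'cV[int]_(m + n),
    [/\ forall y, y \in C' -> forall j, `|lower y j| <= b',
        forall x, E x -> exists2 y, y \in C' & cell y (2 * a') x &
        (size C' * box_count U (side (a' / 2) (b' / 2))
           <= size C * box_count U (side (4 * a) (4 * b')))%N].
Proof.
move=> aa' bb'; elim: C E => [|z C IH] E Eapp Cb Ecov.
  exists [::]; split => // x /Ecov[z].
  by rewrite in_nil.
have [] := @refine_cell (E `&` cell z (2 * a)) a b a' b' z aa' bb'.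
- by move=> x [/Eapp].
- by apply: Cb; rewrite inE eqxx.
- by move=> x [].
move=> C1 [C1b C1cov C1n].
have [|||C2 [C2b C2cov C2n]] := IH (E `\` cell z (2 * a)).
- by move=> x [/Eapp].
- by move=> y yC; apply: Cb; rewrite inE yC orbT.
- move=> x [/Ecov[y]]; rewrite inE => /predU1P[->//|yC] yx _.
  by exists y.
exists (C1 ++ C2); split.
- by move=> y; rewrite mem_cat => /orP[/C1b|/C2b].
- move=> x Ex; have [xz|xz] := pselect (cell z (2 * a) x).
    have [|y yC yx] := C1cov x; first by [].
    by exists y => //; rewrite mem_cat yC.
  have [|y yC yx] := C2cov x; first by [].
  by exists y => //; rewrite mem_cat yC orbT.
- by rewrite size_cat mulnDl /= mulSn leq_add.
Qed.

End Covering.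

(** * Chaining the refinement steps and averaging over the starting time *)

Lemma sum_blocks (R : realType) (f : nat -> R) (J K : nat) :
  \sum_(u < J) \sum_(t < K) f (u + t * J)%N = \sum_(i < K * J) f i.
Proof.
rewrite exchange_big /=; elim: K => [|K IH].
  by rewrite mul0n !big_ord0.
rewrite big_ord_recr IH /= mulSnr big_split_ord /=; congr (_ + _).
by apply: eq_bigr => i _; rewrite addnC.
Qed.

Lemma sum_shift_telescope (R : realType) (g : nat -> R) (a j N : nat) :
  \sum_(i < N) (g (a + i)%N - g (a + j + i)%N) =
  \sum_(i < j) g (a + i)%N - \sum_(i < j) g (a + N + i)%N.
Proof.
rewrite sumrB.
have H1 : \sum_(i < N + j) g (a + i)%N =
    \sum_(i < N) g (a + i)%N + \sum_(i < j) g (a + N + i)%N.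
  by rewrite big_split_ord /=; congr (_ + _); apply: eq_bigr => i _; rewrite addnA.
have H2 : \sum_(i < j + N) g (a + i)%N =
    \sum_(i < j) g (a + i)%N + \sum_(i < N) g (a + j + i)%N.
  by rewrite big_split_ord /=; congr (_ + _); apply: eq_bigr => i _; rewrite addnA.
by apply/eqP; rewrite subr_eq addrAC -H2 addnC H1 addrK.
Qed.

Lemma exists_le_mean (R : realType) (f : nat -> R) (J : nat) : (0 < J)%N ->
  exists2 u, (u < J)%N & J%:R * f u <= \sum_(u < J) f u.
Proof.
move=> J0; apply: contrapT => H.
have : \sum_(v < J) \sum_(u < J) f u < \sum_(v < J) J%:R * f v.
  apply: ltr_sum => [|v _].
    by apply/hasP; exists (Ordinal J0) => //; rewrite mem_index_enum.
  by rewrite ltNge; apply/negP => fv; apply: H; exists v => //; exact: ltn_ord.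
by rewrite sumr_const card_ord -mulr_sumr mulr_natl ltxx.
Qed.

(* P i N reads: stage i has a cover of log-cardinality at most N. Starting the
   chain at i0 + u for each residue u < J and averaging over u turns the sum of
   the terms F (i + J - j) - F (i + J) into a telescoping one. *)
Lemma averaged_chain (R : realType) (P : nat -> R -> Prop) (F G : nat -> R)
    (L B : R) (i0 j J : nat) :
  (0 < j <= J)%N -> (forall l, 0 <= G l) ->
  (forall u, (u < J)%N -> P (i0 + u)%N B) ->
  (forall i N, (i0 <= i)%N -> P i N ->
    P (i + J)%N (N + (L + G (i + J - j)%N + (F (i + J - j)%N - F (i + J)%N)))) ->
  forall K, let I := (i0 + J + K * J)%N in
  exists i N, [/\ (I - J <= i)%N, P i N &
    N <= B + (\sum_(t < j) F (i0 + J - j + t)%N) / J%:R + K%:R * L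
      + (\sum_(l < I) G l - \sum_(t < j) F (I - j + t)%N) / J%:R].
Proof.
move=> /andP[j0 jJ] G0 start step K I.
have J0 : (0 < J)%N := leq_trans j0 jJ.
have JR : 0 < J%:R :> R by rewrite ltr0n.
pose d i := L + G (i + J - j)%N + (F (i + J - j)%N - F (i + J)%N).
have run u K' : (u < J)%N ->
    P (i0 + u + K' * J)%N (B + \sum_(t < K') d (i0 + (u + t * J))%N).
  move=> uJ; elim: K' => [|K' IH].
    by rewrite big_ord0 addr0 addn0; exact: start.
  rewrite big_ord_recr /= addrA mulSnr addnA addnA; apply: step => //.
  by rewrite -addnA leq_addr.
have [u uJ ule] :=
  exists_le_mean (fun u => \sum_(t < K) d (i0 + (u + t * J))%N) J0.
exists (i0 + u + K * J)%N, (B + \sum_(t < K) d (i0 + (u + t * J))%N).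
split; [by rewrite /I; lia|exact: run|].
have : \sum_(u < J) \sum_(t < K) d (i0 + (u + t * J))%N <=
    (K * J)%:R * L + \sum_(l < I) G l
    + (\sum_(t < j) F (i0 + J - j + t)%N - \sum_(t < j) F (I - j + t)%N).
  rewrite (sum_blocks (fun i => d (i0 + i)%N)) /d big_split big_split /=.
  rewrite sumr_const card_ord -[_ *+ (K * J)]mulr_natl.
  have -> : \sum_(i < K * J) (F (i0 + i + J - j)%N - F (i0 + i + J)%N) =
      \sum_(t < j) F (i0 + J - j + t)%N - \sum_(t < j) F (I - j + t)%N.
    have -> : (I - j = i0 + J - j + K * J)%N by rewrite /I; lia.
    rewrite -sum_shift_telescope; apply: eq_bigr => i _.
    have -> : (i0 + i + J - j = i0 + J - j + i)%N by lia.
    by have -> : (i0 + i + J = i0 + J - j + j + i)%N by lia.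
  rewrite lerD2r lerD2l.
  (* The values of [G] that occur form a window of the sum over [l < I]; nonnegativity bounds the
     window by the whole sum. *)
  have -> : I = ((i0 + J - j) + (K * J) + j)%N by rewrite /I; lia.
  rewrite !big_split_ord /= -[leLHS]add0r -[leLHS]addr0.
  apply: lerD; last by rewrite sumr_ge0.
  apply: lerD; first by rewrite sumr_ge0.
  apply: ler_sum => i _; rewrite le_eqVlt; apply/orP; left; apply/eqP.
  by congr G; lia.
move=> /(le_trans ule); rewrite [leLHS]mulrC -ler_pdivlMr// => H.
apply: (le_trans (lerD (lexx B) H)).
rewrite le_eqVlt; apply/orP; left; apply/eqP; rewrite natrM; field.
by rewrite gt_eqF.
Qed.

(** Subtracting the component [p] from an approximant leaves the upper part [A q], which is bounded
    once [q] is. Hence the number of centres is controlled by [A] and [b0] only. *)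
Lemma initial_cover (R : realType) (m n : nat) (A : 'M[R]_(m, n)) (b0 : R) :
  exists N : nat, forall (E : set (torus R m)) a b,
    b <= b0 -> E `<=` approximable A a b ->
    exists C : seq 'cV[int]_(m + n),
      [/\ forall z, z \in C -> forall j, `|lower A z j| <= b,
          forall x, E x -> exists2 z, z \in C & cell A z a x &
          (size C <= N)%N].
Proof.
have Uu : unipotent_mx A \in unitmx := unipotent_unit A.
pose M := \sum_i \sum_j `|A i j| * `|b0|.
exists (box_count (unipotent_mx A) (side M b0)) => E a b bb0 Eapp.
exists [seq z <- fset_set (box (unipotent_mx A) (side M b0)) |
   [forall j, `|lower A z j| <= b]]; split.
- by move=> z; rewrite mem_filter => /andP[/forallP].
- move=> x /Eapp[z [za zb]].
  have low j : lower A (z - col_mx (usubmx z) 0) j = lower A z j.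
    by rewrite lowerB lower_col0 subr0.
  have up i : upper A (z - col_mx (usubmx z) 0) i =
      (A *m map_mx intr (dsubmx z)) i ord0.
    rewrite upperB upper_col0 /upper -{1}[z]vsubmxK embed_col_mx col_mxEu.
    by rewrite [X in X - _]mxE [X in X + _ - _]mxE addrC addKr.
  exists (z - col_mx (usubmx z) 0).
    rewrite mem_filter; apply/andP; split; first by apply/forallP => j; rewrite low.
    rewrite in_box_fset//; apply/asboolP/box_sideP; split => [i|j]; last first.
      by rewrite low (le_trans (zb j)).
    rewrite up mxE (le_trans (ler_norm_sum _ _ _))// /M (bigD1 i)//=.
    rewrite -[leLHS]addr0 lerD ?sumr_ge0// => [|i' _]; last first.
      by rewrite sumr_ge0// => j _; rewrite mulr_ge0.
    apply: ler_sum => j _; rewrite normrM ler_wpM2l//.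
    rewrite (le_trans _ (ler_norm _))// (le_trans _ bb0)//.
    apply: le_trans (zb j); rewrite /lower -[X in embed _ X]vsubmxK.
    by rewrite embed_col_mx col_mxEd.
  exists (usubmx z) => i; rewrite upperB upper_col0 subrK; exact: za.
- by rewrite size_filter (leq_trans (count_size _ _)).
Qed.

Section Chain.
Context {R : realType} {m n : nat}.
Variable A : 'M[R]_(m, n).
Hypotheses (hm : (0 < m)%N) (hn : (0 < n)%N).
(** Time runs in steps of length [eta]. A refinement advances by [h = eta * J], and by [etaj] the
    dilation by [p] is the dilation by [e^x] with [x = eta * j]; [tauJ] is then the inclusion
    condition [(1 + tau) x >= tau h]. By [cdelta], the points of the box dilated by [4 * p] count as
    small for [delta] throughout a time step. *)
Variables (tau delta c eta : R) (p j J : nat).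
Hypotheses (tau0 : 0 < tau) (c0 : 0 < c) (eta0 : 0 < eta) (pp : prime p).
Hypotheses (j0 : (0 < j)%N) (jJ : (j <= J)%N).
Hypothesis etaj : expR (eta * j%:R) = p%:R.
Hypothesis tauJ : tau * J%:R <= (1 + tau) * j%:R.
Hypothesis cdelta : 4 * p%:R * c * expR (tau * eta) < delta.

Let U := unipotent_mx A.
Let Uu : U \in unitmx. Proof. exact: unipotent_unit. Qed.

Let rad (i : nat) : R := c * expR (- tau * (eta * i%:R)).
Let len (i : nat) : R := c * expR (eta * i%:R).

Let rad0 i : 0 < rad i. Proof. by rewrite mulr_gt0// expR_gt0. Qed.
Let len0 i : 0 < len i. Proof. by rewrite mulr_gt0// expR_gt0. Qed.
Let half0 i (k : 'I_(m + n)) : 0 < side (rad i / 2) (len i / 2) k.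
Proof. by apply: side_gt0; rewrite divr_gt0. Qed.

Let f (i : nat) : nat := box_count U (side (rad i / 2) (len i / 2)).

Let f0 i : (0 < f i)%N.
Proof. by apply: box_count_gt0 => // k; rewrite ltW. Qed.

(** [k] is the length of the independent family given by [box_count_prime]. It is constant over a
    whole time step, so that it can later be integrated as a step function below the count of small
    minima. *)
Lemma dilation_bound l : exists k : nat,
  (forall S, expR (eta * l%:R) <= S <= expR (eta * l.+1%:R) ->
     (k <= small_minima_count A tau S delta)%N) /\
  (forall i, (i + J = l + j)%N ->
     (box_count U (side (4 * rad i) (4 * len (i + J)))
        <= p ^ k * 33 ^ (m + n) * f l)%N).
Proof.
have [s [sf sb sn]] :=
  box_count_prime (side (4 * rad l) (4 * len l)) Uu pp.
rewrite !side_scale in sb sn.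
exists (size s); split => [S /andP[S1 S2]|i iJ].
  have S0 : 0 < S by rewrite (lt_le_trans _ S1)// expR_gt0.
  have p0 : 0 < p%:R :> R by rewrite ltr0n prime_gt0.
  have e0 : 0 < 4 * p%:R * c by rewrite !mulr_gt0.
  (* The factor [expR (tau * eta)] pays for the decay of [S ^ (- tau)] within the time step. *)
  apply: (@small_minima_count_ge _ _ _ _ hm hn _ _ _
    (4 * p%:R * c * expR (tau * eta)) _ _ _ S0 _ _ _ sf sb) => //.
  - by rewrite cdelta andbT mulr_gt0// expR_gt0.
  - have -> : p%:R * (4 * rad l) = 4 * p%:R * c * expR (- tau * (eta * l%:R)).
      by rewrite /rad; ring.
    rewrite -[leRHS]mulrA ler_pM2l// /powR gt_eqF// -expRD ler_expR.
    have lnS : ln S <= eta * l.+1%:R by rewrite -ler_expR lnK.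
    have := ler_wpM2l (ltW tau0) lnS; rewrite -natr1; lra.
  - have -> : p%:R * (4 * len l) = 4 * p%:R * c * expR (eta * l%:R).
      by rewrite /len; ring.
    rewrite -[leRHS]mulrA ler_pM2l//; apply: (le_trans S1).
    by rewrite ler_peMl ?(ltW S0)// -expR0 ler_expR mulr_ge0// ltW.
apply: leq_trans (leq_trans _ sn) _.
  (* In the [p] directions the inclusion amounts to [tauJ]; in the [q] directions the sides are
     equal. *)
  apply: le_box_count => // k; apply: le_side.
    rewrite [leRHS]mulrCA ler_pM2l// -etaj /rad [leRHS]mulrCA ler_pM2l// -expRD ler_expR.
    have e : i%:R + J%:R = l%:R + j%:R :> R by rewrite -!natrD iJ.
    have {e} -> : i%:R = l%:R + j%:R - J%:R :> R by rewrite -e addrK.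
    by have := ler_wpM2l (ltW eta0) tauJ; lra.
  rewrite [leRHS]mulrCA ler_pM2l// -etaj /len [leRHS]mulrCA ler_pM2l// -expRD ler_expR iJ.
  by rewrite natrD mulrDr addrC.
rewrite -mulnA leq_mul2l; apply/orP; right.
(* The sides are now [2 * 4 = 8] times [rad l] and [len l], whence the base [33 = 4 * 8 + 1]. *)
have := box_count_scale 8 Uu (fun k => side_gt0 k (rad0 l) (len0 l)).
rewrite !side_scale /f.
have -> : (fun k : 'I_(m + n) => side (rad l) (len l) k / 2) =
    side (rad l / 2) (len l / 2).
  by apply/funext => k; rewrite /side; case: ifP.
apply: leq_trans; apply: le_box_count => // k; apply: le_side.
  by rewrite mulrA -natrM.
by rewrite mulrA -natrM.
Qed.

(** Feeds the refinement step to [averaged_chain], with [ln f] as the telescoping part and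
    [k l * ln p] as the cost of the dilation. [B] is chosen before [K], so it does not grow with
    time. *)
Lemma chain_cover (E : set (torus R m)) (i0 : nat) :
  (forall i, (i0 <= i)%N -> E `<=` approximable A (rad i) (len i)) ->
  exists2 k : nat -> nat,
    (forall l S, expR (eta * l%:R) <= S <= expR (eta * l.+1%:R) ->
       (k l <= small_minima_count A tau S delta)%N) &
  exists B : R, forall K, let I := (i0 + J + K * J)%N in
    exists i (C : seq 'cV[int]_(m + n)),
    [/\ (I - J <= i)%N,
        forall x, E x -> exists2 z, z \in C & cell A z (2 * rad i) x &
        (size C)%:R <= expR (B + K%:R * ln ((33 ^ (m + n))%N%:R)
          + (\sum_(l < I) (k l)%:R * ln p%:R
             - \sum_(t < j) ln (f (I - j + t))%:R) / J%:R)].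
Proof.
move=> Eapp.
have J0 : (0 < J)%N := leq_trans j0 jJ.
have [k kP] := choice dilation_bound.
exists k => [l|]; first by have [] := kP l.
have step l i : (i + J = l + j)%N ->
    (box_count U (side (4 * rad i) (4 * len (i + J)))
       <= p ^ k l * 33 ^ (m + n) * f l)%N by exact: (kP l).2.
have pR : 0 < p%:R :> R by rewrite ltr0n prime_gt0.
have [N0 N0P] := initial_cover A (len (i0 + J)).
pose covered i (N : R) := exists C : seq 'cV[int]_(m + n),
  [/\ forall z, z \in C -> forall j, `|lower A z j| <= len i,
      forall x, E x -> exists2 z, z \in C & cell A z (2 * rad i) x &
      (size C)%:R <= expR N].
have start u : (u < J)%N -> covered (i0 + u)%N (ln N0.+1%:R).
  move=> uJ; have [||C [C1 C2 C3]] := N0P E (rad (i0 + u)) (len (i0 + u)).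
  - by rewrite ler_pM2l// ler_expR ler_pM2l// ler_nat leq_add2l ltnW.
  - by apply: Eapp; rewrite leq_addr.
  exists C; split => // [x /C2[z zC [q zx]]|].
    exists z => //; exists q => i; apply: le_trans (zx i) _.
    by rewrite ler_peMl ?ler1n// ltW.
  by rewrite lnK ?posrE// ler_nat (leq_trans C3).
have refine i N : (i0 <= i)%N -> covered i N ->
    covered (i + J)%N (N + (ln (33 ^ (m + n))%N%:R
      + (k (i + J - j)%N)%:R * ln p%:R
      + (ln (f (i + J - j))%:R - ln (f (i + J))%:R))).
  move=> i0i [C [C1 C2 C3]].
  have [|||||C' [C'1 C'2 C'3]] :=
    @refine_cover _ _ _ A E (rad i) (len i) (rad (i + J)) (len (i + J)) C.
  - rewrite rad0/= ler_pM2l// ler_expR !mulNr lerN2 ler_pM2l// ler_pM2l//.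
    by rewrite ler_nat leq_addr.
  - by rewrite len0/= ler_pM2l// ler_expR ler_pM2l// ler_nat leq_addr.
  - by apply: Eapp; rewrite (leq_trans i0i)// leq_addr.
  - exact: C1.
  - exact: C2.
  exists C'; split => //.
  have iJ : (i + J = i + J - j + j)%N.
    by rewrite subnK// (leq_trans jJ)// leq_addl.
  have := leq_trans C'3 (leq_mul (leqnn _) (step _ _ iJ)).
  rewrite -/(f (i + J)).
  have := f0 (i + J); have := f0 (i + J - j).
  move: (f (i + J - j)) (f (i + J)) (k (i + J - j)%N) => a b e a0 b0 H.
  have W0 : (0 < 33 ^ (m + n))%N by rewrite expn_gt0.
  move: W0 H; move: (33 ^ (m + n))%N => W W0 H.
  rewrite !expRD expRM_natl expRN.
  rewrite !lnK ?posrE ?ltr0n// ?prime_gt0//.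
  rewrite !mulrA ler_pdivlMr ?ltr0n//.
  apply: (@le_trans _ _ (size C * (p ^ e * W * a))%N%:R).
    by rewrite -natrM ler_nat.
  rewrite !natrM natrX !mulrA ler_wpM2r// [leRHS]mulrAC ler_wpM2r//.
  by rewrite ler_wpM2r// exprn_ge0.
have jJ' : (0 < j <= J)%N by rewrite j0.
have G0 l : 0 <= (k l)%:R * ln p%:R :> R.
  by rewrite mulr_ge0// ln_ge0// ler1n prime_gt0.
have avg := @averaged_chain R covered (fun i => ln (f i)%:R) _ _ _ _ _ _ jJ' G0
  start refine.
eexists => K; have [i [N [iI [C [_ C2 C3]] NB]]] := avg K.
exists i, C; split; [exact: iI|exact: C2|].
by apply: (le_trans C3); rewrite ler_expR; exact: NB.
Qed.
End Chain.

(** * The integral of the counting function *)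

(* The integral of a nonnegative function is a supremum over simple functions
   below it, so it is monotone even on functions that are not known to be
   measurable, such as the count of small minima. *)
Lemma le_lower_integral d (T : measurableType d) (R : realType)
    (mu : {measure set T -> \bar R}) (D : set T) (f g : T -> \bar R) :
  (forall x, D x -> (0 <= f x)%E) -> (forall x, D x -> (f x <= g x)%E) ->
  (\int[mu]_(x in D) f x <= \int[mu]_(x in D) g x)%E.
Proof.
move=> f0 fg; rewrite !ge0_integralE// => [|x Dx]; last first.
  exact: le_trans (f0 _ Dx) (fg _ Dx).
apply: ereal_sup_le => _ [h hf <-]; exists h => // x.
apply: le_trans (hf x) _; rewrite /patch; case: ifPn => // /set_mem.
exact: fg.
Qed.

Section InverseIntegral.
Context {R : realType}.
Implicit Types (a b : R).

Lemma inv_within_continuous a b : 0 < a ->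
  {within `[a, b], continuous (fun S : R => S^-1)}.
Proof.
move=> a0; apply: continuous_in_subspaceT => S /set_mem.
rewrite /= in_itv/= => /andP[aS _].
by apply: inv_continuous; rewrite gt_eqF// (lt_le_trans a0).
Qed.

Lemma inv_measurable a b : 0 < a ->
  measurable_fun `[a, b] (fun S : R => S^-1).
Proof.
move=> a0; apply: subspace_continuous_measurable_fun => //.
exact: inv_within_continuous.
Qed.

Lemma integral_inv a b : 0 < a < b ->
  (\int[lebesgue_measure]_(S in `[a, b]) (S^-1)%:E = (ln b - ln a)%:E)%E.
Proof.
move=> /andP[a0 ab]; have b0 := lt_trans a0 ab.
rewrite (continuous_FTC2 (F := @ln R) ab)//.
- exact: inv_within_continuous.
- split.
  + move=> S; rewrite in_itv/= => /andP[aS _].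
    have S0 := lt_trans a0 aS.
    exact: (@ex_derive _ _ _ _ _ _ _ (is_derive1_ln S0)).
  + exact/cvg_at_right_filter/continuous_ln.
  + exact/cvg_at_left_filter/continuous_ln.
- move=> S; rewrite in_itv/= => /andP[aS _].
  have S0 := lt_trans a0 aS.
  by rewrite derive1E; exact: (@derive_val _ _ _ _ _ _ _ (is_derive1_ln S0)).
Qed.

(** Uses [1 / S <= 1] on [[1, T]]. Finiteness matters because the real integral is the [fine] part
    of the extended one, and [fine] is 0 at infinity. *)
Lemma Rintegral_count_bound (r : R -> nat) (d : nat) (T : R) :
  1 <= T -> (forall S, (r S <= d)%N) ->
  (0 <= \int[lebesgue_measure]_(S in `[1%R, T]) ((r S)%:R / S)%:E
     <= (d%:R * (T - 1))%:E)%E.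
Proof.
move=> T1 rd.
have S0 S : `[1, T]%classic S -> 0 < S.
  by rewrite /= in_itv/= => /andP[+ _]; exact: lt_le_trans.
apply/andP; split.
  by apply: integral_ge0 => S ST; rewrite lee_fin mulr_ge0// invr_ge0 ltW// S0.
apply: (@le_trans _ _ (\int[lebesgue_measure]_(S in `[1%R, T]) cst d%:R%:E S)%E).
  apply: le_lower_integral => S ST; rewrite lee_fin.
    by rewrite mulr_ge0// invr_ge0 ltW// S0.
  rewrite ler_pdivrMr ?S0//; move: ST; rewrite /= in_itv/= => /andP[S1 _].
  by rewrite -[leLHS]mulr1 ler_pM// ler_nat.
rewrite integral_cst//= lebesgue_measure_itv/= lte_fin EFinM.
case: ifP => _; first by rewrite -EFinD.
by rewrite mule0 mule_ge0// lee_fin ?subr_ge0.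
Qed.

Lemma le_Rintegral_count (r r' : R -> nat) (d : nat) (T : R) :
  1 <= T -> (forall S, (r' S <= d)%N) ->
  (forall S, 1 <= S -> (r S <= r' S)%N) ->
  \int[lebesgue_measure]_(S in `[1, T]) ((r S)%:R / S)
    <= \int[lebesgue_measure]_(S in `[1, T]) ((r' S)%:R / S).
Proof.
move=> T1 r'd rr'.
have le_int : (\int[lebesgue_measure]_(S in `[1%R, T]) ((r S)%:R / S)%:E
    <= \int[lebesgue_measure]_(S in `[1%R, T]) ((r' S)%:R / S)%:E)%E.
  apply: le_lower_integral => S; rewrite /= in_itv/= => /andP[S1 _].
    by rewrite lee_fin mulr_ge0// invr_ge0 (le_trans _ S1).
  by rewrite lee_fin ler_wpM2r ?ler_nat ?rr'// invr_ge0 (le_trans _ S1).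
have /andP[_ ub] := Rintegral_count_bound T1 r'd.
have lb : (0 <= \int[lebesgue_measure]_(S in `[1%R, T]) ((r S)%:R / S)%:E)%E.
  apply: integral_ge0 => S; rewrite /= in_itv/= => /andP[S1 _].
  by rewrite lee_fin mulr_ge0// invr_ge0 (le_trans _ S1).
rewrite /Rintegral fine_le//.
  by rewrite ge0_fin_numE// (le_lt_trans le_int)// (le_lt_trans ub)// ltry.
rewrite ge0_fin_numE; first by rewrite (le_lt_trans ub)// ltry.
exact: le_trans lb le_int.
Qed.

(** Each time step has mass [eta] for [dS / S], so the left side is the integral of a measurable
    step function lying below the count. *)
Lemma Rintegral_step_ge (r : R -> nat) (d : nat) (k : nat -> nat) (eta T : R)
    (I : nat) : 0 < eta -> (forall S, (r S <= d)%N) ->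
  (forall l S, expR (eta * l%:R) <= S <= expR (eta * l.+1%:R) ->
     (k l <= r S)%N) ->
  expR (eta * I%:R) <= T ->
  eta * \sum_(l < I) (k l)%:R <= \int[lebesgue_measure]_(S in `[1, T]) ((r S)%:R / S).
Proof.
move=> eta0 rd kr IT.
pose e l : R := expR (eta * l%:R).
have e0 l : 0 < e l by exact: expR_gt0.
have le_e l l' : (l <= l')%N -> e l <= e l'.
  by move=> ll'; rewrite ler_expR ler_pM2l// ler_nat.
have e1 l : 1 <= e l by rewrite -expR0 ler_expR mulr_ge0// ltW.
have S0 S : `[1, T]%classic S -> 0 < S.
  by rewrite /= in_itv/= => /andP[+ _]; exact: lt_le_trans.
have T1 : 1 <= T := le_trans (e1 I) IT.
pose piece l := `[e l, e l.+1[%classic.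
pose g l : R -> \bar R := (fun S => ((k l)%:R * S^-1)%:E) \_ (piece l).
have mg l : measurable_fun `[1, T] (g l).
  apply/measurable_restrict; [exact: measurable_itv|exact: measurable_itv|].
  apply/measurable_EFinP.
  apply: measurable_funM => //; apply: (measurable_funS _ _ (@inv_measurable 1 T ltr01)) => //.
have g0 l S : `[1, T]%classic S -> (0 <= g l S)%E.
  move=> /S0 S0'; rewrite /g /patch; case: ifP => // _.
  by rewrite lee_fin mulr_ge0// invr_ge0 ltW.
have intg l : (l < I)%N ->
    (\int[lebesgue_measure]_(S in `[1%R, T]) g l S = ((k l)%:R * eta)%:E)%E.
  move=> lI; rewrite /g -integral_mkcondr.
  have -> : setI `[1, T]%classic (piece l) = piece l.
    apply/setIidPr => S; rewrite /piece /= !in_itv/= => /andP[S1 S2].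
    rewrite (le_trans (e1 l) S1)/= (le_trans (ltW S2))//.
    exact: le_trans (le_e _ _ lI) IT.
  have mi : measurable_fun (piece l) (fun S : R => ((S)^-1)%:E).
    apply/measurable_EFinP.
    apply: (measurable_funS _ _ (@inv_measurable (e l) (e l.+1) (e0 l))) => // S.
    by rewrite /piece /= !in_itv/= => /andP[-> /ltW].
  under eq_integral do rewrite EFinM.
  rewrite ge0_integralZl//; [|exact: measurable_itv|]; last first.
    move=> S; rewrite /piece /= in_itv/= => /andP[S1 _].
    by rewrite lee_fin invr_ge0 ltW// (lt_le_trans (e0 l)).
  rewrite integral_itv_bndo_bndc//.
  rewrite integral_inv; last first.
    by rewrite e0/= ltr_expR ltr_pM2l// ltr_nat.
  rewrite /e !expRK -EFinM; congr (_ * _)%:E.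
  by rewrite -natr1; ring.
have /andP[_ upper] := Rintegral_count_bound T1 rd.
have lower : ((eta * \sum_(l < I) (k l)%:R)%:E <=
    \int[lebesgue_measure]_(S in `[1%R, T]) ((r S)%:R / S)%:E)%E.
  have -> : ((eta * \sum_(l < I) (k l)%:R)%:E =
      \int[lebesgue_measure]_(S in `[1%R, T]) (\sum_(l < I) g l S))%E.
    rewrite ge0_integral_sum; [|exact: measurable_itv|move=> l; exact: mg|
      move=> l S; exact: g0].
    rewrite mulr_sumr -sumEFin.
    by apply: eq_bigr => l _; rewrite intg// mulrC.
  apply: le_lower_integral => S ST; first by apply: sume_ge0 => l _; exact: g0.
  have gout l : ~ piece l S -> g l S = 0%E.
    by move=> H; rewrite /g /patch; case: ifPn => // /set_mem.
  have [[l Sl]|no] := pselect (exists l : 'I_I, piece l S); last first.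
    rewrite big1 => [|l _]; last by apply: gout => Sl; apply: no; exists l.
    by rewrite lee_fin mulr_ge0// invr_ge0 ltW// S0.
  move: (Sl); rewrite /piece /= in_itv/= => /andP[S1 S2].
  rewrite (bigD1 l)//= big1 => [|l' l'l]; last first.
    apply: gout; rewrite /piece /= in_itv/= => /andP[S3 S4].
    move/negP: l'l; apply; rewrite -val_eqE/= eqn_leq -[(l' <= l)%N]ltnS -[(l <= l')%N]ltnS.
    apply/andP; split; rewrite ltnNge; apply/negP => /le_e.
      by move=> /(lt_le_trans S2)/(le_lt_trans S3); rewrite ltxx.
    by move=> /(lt_le_trans S4)/(le_lt_trans S1); rewrite ltxx.
  rewrite adde0 /g /patch mem_set// lee_fin ler_wpM2r ?invr_ge0 ?(ltW (S0 _ ST))//.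
  by rewrite ler_nat; apply: kr; rewrite S1 ltW.
rewrite -lee_fin /Rintegral fineK//.
rewrite fin_numE; apply/andP; split.
  by rewrite gt_eqF// (lt_le_trans _ lower)// ltNyr.
by rewrite lt_eqF// (le_lt_trans upper)// ltry.
Qed.
End InverseIntegral.

(** * Counting the balls of the cover *)

Section CoverCount.
Context {R : realType} {m n : nat}.
Variable A : 'M[R]_(m, n).
Hypotheses (hm : (0 < m)%N) (hn : (0 < n)%N).
Variables (tau delta c eta : R) (p j J : nat).
Hypotheses (tau0 : 0 < tau) (c0 : 0 < c) (eta0 : 0 < eta) (pp : prime p).
Hypotheses (j0 : (0 < j)%N) (jJ : (j <= J)%N).
Hypothesis etaj : expR (eta * j%:R) = p%:R.
Hypothesis tauJ : tau * J%:R <= (1 + tau) * j%:R.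
Hypothesis cdelta : 4 * p%:R * c * expR (tau * eta) < delta.

Let U := unipotent_mx A.
Let Uu : U \in unitmx. Proof. exact: unipotent_unit. Qed.
Let rad (i : nat) : R := c * expR (- tau * (eta * i%:R)).
Let len (i : nat) : R := c * expR (eta * i%:R).
Let rad0 i : 0 < rad i. Proof. by rewrite mulr_gt0// expR_gt0. Qed.
Let len0 i : 0 < len i. Proof. by rewrite mulr_gt0// expR_gt0. Qed.
Let half0 i (k : 'I_(m + n)) : 0 < side (rad i / 2) (len i / 2) k.
Proof. by apply: side_gt0; rewrite divr_gt0. Qed.
Let f (i : nat) : nat := box_count U (side (rad i / 2) (len i / 2)).
Let f0 i : (0 < f i)%N.
Proof. by apply: box_count_gt0 => // k; rewrite ltW. Qed.

Let W : R := (33 ^ (m + n))%N%:R.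

Lemma covering_product_ge1 r q : 1 <= covering_product A r q.
Proof.
rewrite /covering_product; apply: (big_ind (fun x => 1 <= x)) => // [x y x1 y1|i _].
  exact: mulr_ege1.
by rewrite le_max lexx orbT.
Qed.

(** As [ln T] is at most [2 * J] steps after time [l], the box of sides [T ^ (- tau)], [T] lies in a
    dilate, by a factor [kap] independent of [T] and [l], of the box counted by [f l]; this changes
    the count by a bounded factor. *)
Lemma covering_product_box : exists2 C1 : R, 0 < C1 &
  forall T l, 0 < T -> eta * l%:R <= ln T <= eta * (l%:R + 2 * J%:R) ->
  covering_product A (T `^ (- tau)) T <= C1 * (f l)%:R.
Proof.
pose kap := (Num.truncn (2 / c * expR (eta * (2 * J%:R)))).+1.
have kapP : expR (eta * (2 * J%:R)) <= kap%:R * (c / 2).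
  have := truncnS_gt (2 / c * expR (eta * (2 * J%:R))); rewrite -/kap => /ltW.
  rewrite mulrC -ler_pdivlMr ?divr_gt0//.
  by rewrite invf_div.
exists ((2 * (m + n))%:R ^+ (m + n) * ((4 * kap).+1 ^ (m + n))%N%:R).
  rewrite mulr_gt0 ?exprn_gt0 ?ltr0n ?muln_gt0 ?addn_gt0 ?hm//.
  by rewrite expn_gt0.
move=> T l T0 /andP[T1 T2].
have r0 : 0 < T `^ (- tau) by rewrite powR_gt0.
apply: (le_trans (covering_product_le A hm hn r0 T0)).
rewrite -mulrA ler_wpM2l ?exprn_ge0// -natrM ler_nat -/U.
apply: (@leq_trans (box_count U (fun i => kap%:R * side (rad l / 2) (len l / 2) i))).
  apply: le_box_count => // i.
  have := congr1 (fun h => h i) (side_scale kap%:R (rad l / 2) (len l / 2)).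
  move=> /= ->; apply: le_side.
    rewrite /rad mulrAC mulrA -[leLHS]mul1r ler_pM//.
    - by rewrite powR_ge0.
    - by rewrite (le_trans _ kapP)// -expR0 ler_expR !mulr_ge0// ltW.
    - by rewrite /powR gt_eqF// ler_expR !mulNr lerN2 ler_pM2l.
  rewrite /len mulrAC mulrA -{1}[T]lnK ?posrE//.
  apply: (@le_trans _ _ (expR (eta * (2 * J%:R)) * expR (eta * l%:R))).
    by rewrite -expRD ler_expR (le_trans T2)// -mulrDr addrC.
  by rewrite ler_wpM2r// expR_ge0.
apply: (leq_trans (box_count_scale _ Uu (half0 l))).
rewrite leq_mul2l; apply/orP; right; apply: le_box_count => // i.
by rewrite ler_pdivrMr// ler_peMr ?ler1n// ltW// half0.
Qed.

(** Passes from discrete times to a real [T]. The constant [W] is paid once every [J] steps, hence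
    the slope [ln W / (eta * J)]; boundary terms go into [B]. *)
Lemma cover_count (E : set (torus R m)) (i0 : nat) :
  (forall i, (i0 <= i)%N -> E `<=` approximable A (rad i) (len i)) ->
  exists B T0 : R, forall T, T0 <= T ->
    exists a (C : seq 'cV[int]_(m + n)),
    [/\ 0 < a <= c * expR (tau * (eta * (2 * J%:R))) * T `^ (- tau),
        forall x, E x -> exists2 z, z \in C & cell A z (2 * a) x &
        (size C)%:R <= expR (B + ln W / (eta * J%:R) * ln T + j%:R / J%:R *
          (\int[lebesgue_measure]_(S in `[1, T])
              ((small_minima_count A tau S delta)%:R / S)
            - ln (covering_product A (T `^ (- tau)) T)))].
Proof.
move=> Eapp.
have J0 : (0 < J)%N := leq_trans j0 jJ.
have JR : 0 < J%:R :> R by rewrite ltr0n.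
have [k kP [B BP]] := chain_cover hm hn tau0 c0 eta0 pp j0 jJ etaj tauJ cdelta Eapp.
have [C1 C10 C1P] := covering_product_box.
exists (B + j%:R / J%:R * ln C1), (expR (eta * (i0 + J)%:R)) => T T0T.
have T0 : 0 < T by rewrite (lt_le_trans _ T0T)// expR_gt0.
(* The largest number of refinements for which [eta * I] does not exceed [ln T]. *)
pose K := Num.truncn ((ln T / eta - (i0 + J)%:R) / J%:R).
have lnT : eta * (i0 + J)%:R <= ln T by rewrite -ler_expR lnK.
have /andP[K1 K2] :
    K%:R * J%:R <= ln T / eta - (i0 + J)%:R < (K%:R + 1) * J%:R.
  rewrite -ler_pdivlMr// -ltr_pdivrMr// natr1; apply: truncn_itv.
  apply: divr_ge0; last exact: ltW.
  by rewrite subr_ge0 ler_pdivlMr// mulrC.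
set I := (i0 + J + K * J)%N.
have IR : I%:R = (i0 + J)%:R + K%:R * J%:R :> R by rewrite /I natrD natrM.
have I1 : eta * I%:R <= ln T.
  by rewrite mulrC -ler_pdivlMr// IR addrC -lerBrDr.
have I2 : ln T <= eta * (I%:R + J%:R).
  rewrite mulrC -ler_pdivrMr// IR -addrA -lerBlDl.
  by rewrite (le_trans (ltW K2))// mulrDl mul1r.
have JI : (J <= I)%N by rewrite /I -addnA addnCA leq_addr.
have [i [C [iI C2 C3]]] : exists i (C : seq 'cV[int]_(m + n)),
    [/\ (I - J <= i)%N,
        forall x, E x -> exists2 z, z \in C & cell A z (2 * rad i) x &
        (size C)%:R <= expR (B + K%:R * ln W
          + (\sum_(l < I) (k l)%:R * ln p%:R
             - \sum_(t < j) ln (f (I - j + t))%:R) / J%:R)].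
  exact: BP K.
exists (rad i), C; split => //.
  (* The chain may stop [J] steps before [I], and [ln T] may lie up to [J] steps after it, hence
     [2 * J]. *)
  rewrite rad0 /= /rad -mulrA ler_pM2l// /powR gt_eqF// -expRD ler_expR.
  have H : eta * (I%:R - J%:R) <= eta * i%:R.
    by rewrite ler_pM2l// -natrB// ler_nat.
  have {}H : ln T - eta * (2 * J%:R) <= eta * i%:R.
    by apply: le_trans H; lra.
  by have := ler_wpM2l (ltW tau0) H; lra.
apply: (le_trans C3); rewrite ler_expR.
have W0 : 0 <= ln W.
  by rewrite ln_ge0// /W ler1n expn_gt0.
have partK : K%:R * ln W <= ln W / (eta * J%:R) * ln T.
  rewrite mulrC -mulrA ler_wpM2l// invfM mulrC mulrA ler_pdivlMr//.
  by rewrite (le_trans K1)// lerBlDr lerDl.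
have lnp : ln p%:R = eta * j%:R :> R by rewrite -etaj expRK.
have jJR : 0 < j%:R / J%:R :> R by rewrite divr_gt0// ltr0n.
have partk : (\sum_(l < I) (k l)%:R * ln p%:R) / J%:R <= j%:R / J%:R *
    \int[lebesgue_measure]_(S in `[1, T])
       ((small_minima_count A tau S delta)%:R / S).
  rewrite -mulr_suml lnp.
  have -> : (\sum_(l < I) (k l)%:R) * (eta * j%:R) =
      j%:R * (eta * \sum_(l < I) (k l)%:R) :> R.
    by rewrite [eta * j%:R]mulrC mulrCA; congr (_ * _); rewrite mulrC.
  rewrite mulrAC ler_pM2l//.
  apply: (@Rintegral_step_ge _ _ (m + n)) => //.
    move=> S; rewrite /small_minima_count size_filter.
    by rewrite (leq_trans (count_size _ _))// size_iota.
  by rewrite -[leRHS]lnK ?posrE// ler_expR.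
have partf : j%:R / J%:R * ln (covering_product A (T `^ (- tau)) T)
    - j%:R / J%:R * ln C1 <= (\sum_(t < j) ln (f (I - j + t))%:R) / J%:R.
  rewrite -mulrBr mulrAC ler_pM2r ?invr_gt0//.
  rewrite mulr_natl -[X in _ *+ X]card_ord -sumr_const; apply: ler_sum => t _.
  have f0R : 0 < (f (I - j + t))%:R :> R by rewrite ltr0n.
  rewrite lerBlDl -lnM ?posrE// ler_ln ?posrE ?mulr_gt0//; last first.
    by rewrite (lt_le_trans ltr01)// covering_product_ge1.
  apply: C1P => //; apply/andP; split.
    apply: le_trans I1; rewrite ler_pM2l// ler_nat.
    rewrite (leq_trans (leq_add (leqnn _) (ltnW (ltn_ord t))))//.
    by rewrite subnK// (leq_trans jJ).
  apply: (le_trans I2); rewrite ler_pM2l// mulr_natl mulr2n addrA lerD2r.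
  rewrite -natrD ler_nat -{1}(subnK (leq_trans jJ JI)) -addnA leq_add2l.
  by rewrite (leq_trans jJ)// leq_addl.
by rewrite mulrBl mulrBr; lra.
Qed.
End CoverCount.

(** * Hausdorff measure *)

Section HausdorffMeasure.
Context {R : realType} {X : metricType R}.
Implicit Types (E : set X) (s : R).
Local Open Scope ereal_scope.

Lemma diam_ge0 E : E !=set0 -> 0 <= diam E.
Proof.
move=> [x Ex]; apply: ereal_sup_ubound; exists (x, x) => //=.
by rewrite mdistxx.
Qed.

Lemma diam_set0 : diam (set0 : set X) = -oo.
Proof.
rewrite /diam (_ : [set _ | _ in _] = set0) ?ereal_sup0//.
by apply/seteqP; split => // y [[x x'] []].
Qed.

Lemma diam_poweR_le E s (r : R) : (0 <= s)%R -> E !=set0 -> diam E <= r%:E ->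
  diam E `^ s <= (r `^ s)%:E.
Proof.
move=> s0 E0 Er; rewrite -poweR_EFin.
have d0 := diam_ge0 E0.
apply: gt0_ler_poweR => //; rewrite in_itv/= ?d0 ?leey//=.
by rewrite (le_trans d0 Er) ?leey.
Qed.

Lemma hausdorff_premeasure_ge0 s delta E : 0 <= hausdorff_premeasure s delta E.
Proof.
apply: le_ereal_inf_tmp => _ [U _ <-]; apply: nneseries_ge0 => i _ _.
exact: poweR_ge0.
Qed.

(** Countable subadditivity: the [i]-th set is covered at cost [e / 2 ^ i.+1], and the double family
    of covers is enumerated through a bijection of [nat] with [nat * nat]. *)
Lemma hausdorff_measure_eq0 (S : nat -> set X) E s : (0 <= s)%R ->
  E `<=` \bigcup_i S i ->
  (forall i (e : R), (0 < e)%R -> exists N (r : R) (V : nat -> set X),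
    [/\ (0 <= r <= e)%R, S i `<=` \bigcup_(l in `I_N) V l,
        forall l, diam (V l) <= r%:E & (N%:R * r `^ s <= e)%R]) ->
  hausdorff_measure s E = 0.
Proof.
move=> s0 ES cov; apply/eqP; rewrite eq_le; apply/andP; split; last first.
  apply: le_trans (hausdorff_premeasure_ge0 s 1%R E) _.
  by apply: ereal_sup_ubound; exists 1%R => //=; exact: ltr01.
apply: ge_ereal_sup => _ [delta /= delta0 <-].
apply/lee_addgt0Pr => e e0; rewrite add0e.
pose ei i : R := Num.min delta (e / (2 ^ i.+1)%:R)%R.
have ei0 i : (0 < ei i)%R by rewrite lt_min delta0 divr_gt0// ltr0n expn_gt0.
have /choice[N /choice[r /choice[V NrV]]] := fun i => cov i (ei i) (ei0 i).
have /card_esym/ppcard_eqP[f] := card_nat2.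
(* Each finite cover is padded with empty sets, which the sum leaves out. *)
pose W (k : nat * nat) := if (k.2 < N k.1)%N then V k.1 k.2 else set0.
pose b (k : nat * nat) : \bar R :=
  if (k.2 < N k.1)%N then (r k.1 `^ s)%:E else 0.
have b0 k : 0 <= b k by rewrite /b; case: ifP => // _; rewrite lee_fin powR_ge0.
apply: (@le_trans _ _ (\sum_(i <oo | W (f i) != set0) diam (W (f i)) `^ s)).
  apply: ereal_inf_lbound; exists (W \o f) => //=; split.
    move=> x /ES[i _ xi]; have [_ + _ _] := NrV i.
    move=> /(_ _ xi)[l lN xl]; exists (f^-1%FUN (i, l)) => //=.
    have -> : f (f^-1%FUN (i, l)) = (i, l) by apply: invK; exact: mem_setT.
    by rewrite /W /= lN.
  move=> i; rewrite /W; case: ifP => _; last by rewrite diam_set0 leNye.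
  have [/andP[_ rle] _ + _] := NrV (f i).1.
  move=> /(_ (f i).2) /le_trans; apply.
  by rewrite lee_fin (le_trans rle)// ge_min lexx.
apply: (@le_trans _ _ (\sum_(i <oo) b (f i))).
  rewrite eseries_mkcond; apply: lee_nneseries => [i _ _|i _].
    by case: ifP => // _; exact: poweR_ge0.
  case: ifPn => [/set0P W0|_]; last exact: b0.
  move: W0; rewrite /W /b; case: ifP => [_ W0|_ [//]].
  by have [_ _ + _] := NrV (f i).1 => /(_ (f i).2); exact: diam_poweR_le.
rewrite nneseries_esumT// -(reindex_esum [set: nat] [set: nat * nat] f)//.
rewrite (_ : [set: nat * nat] = setT `*`` (fun=> setT)); last first.
  by apply/seteqP; split.
rewrite -(@esum_esum _ _ _ _ _ (fun i j => b (i, j)))//.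
rewrite -nneseries_esumT => [|i]; last by apply: esum_ge0.
apply: le_trans (epsilon_trick0 xpredT (ltW e0)).
apply: lee_nneseries => [i _ _|i _]; first by apply: esum_ge0.
rewrite -nneseries_esumT// (nneseries_split 0 (N i))// add0n.
rewrite eseries0 ?adde0 => [|l Nl _]; last by rewrite /b /= ltnNge Nl.
rewrite (eq_big_nat _ _ (F2 := fun=> (r i `^ s)%:E)); last first.
  by move=> l /andP[_ lN]; rewrite /b /= lN.
rewrite sumEFin lee_fin sumr_const_nat subn0 -[leLHS]mulr_natl.
have [_ _ _ H] := NrV i; apply: (le_trans H).
by rewrite ge_min lexx orbT.
Qed.

End HausdorffMeasure.

(** * The singular set *)

Section Torus.
Context {R : realType} {m n : nat}.
Variable A : 'M[R]_(m, n).
Implicit Types (v : 'cV[R]_m) (x y : torus R m).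

Lemma cV_norm_le k (v : 'cV[R]_k) (a : R) : 0 <= a ->
  (forall i, `|v i ord0| <= a) -> `|v| <= a.
Proof.
move=> a0 va; rewrite [leLHS]/Num.norm /= mx_normrE.
by apply/bigmax_leP; split => // -[i j] _ /=; rewrite (ord1 j).
Qed.

Lemma le_cV_norm k (v : 'cV[R]_k) i : `|v i ord0| <= `|v|.
Proof.
rewrite [leRHS]/Num.norm /= mx_normrE.
by apply/bigmax_geP; right; exists (i, ord0).
Qed.

Lemma diam_cell z (a : R) : 0 <= a -> (diam (cell A z a) <= (2 * a)%:E)%E.
Proof.
move=> a0; apply: ge_ereal_sup => _ [[x y] /= [[p px] [q qy]] <-].
rewrite lee_fin torus_mdistE.
have -> : x - y = torus_pi (torus_lift x - torus_lift y - map_mx intr (p - q)).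
  rewrite -{1}[x]torus_liftK -{1}[y]torus_liftK -torus_piN -torus_piD.
  apply/torus_pi_eq; rewrite opprB addrC subrK.
  by apply/int_vectorP; exists (p - q).
apply: (le_trans (torus_norm_le _)); apply: cV_norm_le; first by rewrite mulr_ge0.
move=> i; rewrite !mxE intrB.
have := px i; have := qy i; rewrite !ler_norml => /andP[? ?] /andP[? ?].
by apply/andP; split; lra.
Qed.

(** The definition is applied with constant [c ^ (1 + tau)] at [T = c * expR (eta * i)], where the
    error becomes exactly [c * expR (- tau * (eta * i))]. The threshold depends on the point, hence
    the countable union over [i0]. *)
Lemma singular_set_approximable (tau c eta : R) : 0 < tau -> 0 < c -> 0 < eta ->
  singular_set A (power_fun tau) `<=`
  \bigcup_i0 [set x | forall i, (i0 <= i)%N ->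
     approximable A (c * expR (- tau * (eta * i%:R))) (c * expR (eta * i%:R)) x].
Proof.
move=> tau0 c0 eta0 x xS.
have c1 : 0 < c `^ (1 + tau) by rewrite powR_gt0.
have [M [Mreal MP]] := xS _ c1.
pose i0 := (Num.truncn (`|M| / c / eta)).+1.
exists i0 => // i i0i.
have MT : M < c * expR (eta * i%:R).
  apply: (le_lt_trans (ler_norm M)); rewrite [ltRHS]mulrC -ltr_pdivrMr//.
  apply: (@lt_le_trans _ _ (eta * i%:R)).
    rewrite [ltRHS]mulrC -ltr_pdivrMr//; apply: lt_le_trans (truncnS_gt _) _.
    by rewrite ler_nat.
  by apply: le_trans (expR_ge1Dx _); rewrite lerDr.
have [p [q [/int_vectorP[P ->] /int_vectorP[Q ->] H1 H2]]] := MP _ MT.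
exists (col_mx (- P) Q); split => [k|k]; last first.
  rewrite /lower embed_col_mx col_mxEd; apply: le_trans H2; exact: le_cV_norm.
have -> : c * expR (- tau * (eta * i%:R)) =
    c `^ (1 + tau) * power_fun tau (c * expR (eta * i%:R)).
  rewrite /power_fun powRM ?expR_ge0 ?(ltW c0)//.
  rewrite mulrA -powRD; last by rewrite (gt_eqF c0) implybT.
  rewrite addrK powRr1 ?(ltW c0)//; congr (_ * _).
  by rewrite /powR gt_eqF ?expR_gt0// expRK.
apply: le_trans H1; apply: le_trans (le_cV_norm _ k).
rewrite /upper embed_col_mx col_mxEu.
by rewrite !mxE le_eqVlt; apply/orP; left; apply/eqP; congr `|_ - _|; rewrite intrN addrC.
Qed.

(** The class of 0 is approximated exactly with [q = 0]. Nonemptiness later forces the liminf to be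
    nonnegative. *)
Lemma singular_set_neq0 (tau : R) : singular_set A (power_fun tau) !=set0.
Proof.
exists 0 => c /= c0.
have lint : int_vector (torus_lift (0 : torus R m)).
  by rewrite -[torus_lift 0]subr0; apply/torus_pi_eq; rewrite torus_liftK torus_pi0.
have [P PE] := (int_vectorP _).1 lint.
near=> T; exists (- torus_lift 0), 0; split.
- by apply/int_vectorP; exists (- P); rewrite map_mxN -PE.
- by apply/int_vectorP; exists 0; rewrite map_mx0.
- by rewrite mulmx0 sub0r opprK subrr normr0 mulr_ge0 ?powR_ge0// ltW.
- by rewrite normr0; near: T; exact: nbhs_pinfty_ge.
Unshelve. all: by end_near. Qed.

End Torus.

(** For exponent 0 every nonempty member of a cover contributes 1, even when its diameter is 0. *)
Lemma hausdorff_measure0_gt0 (R : realType) (X : metricType R) (E : set X) :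
  E !=set0 -> hausdorff_measure 0 E <> 0%E.
Proof.
move=> [x Ex] H0; have : (1 <= hausdorff_measure 0 E)%E.
  apply: (@le_trans _ _ (hausdorff_premeasure 0 1%R E)); last first.
    by apply: ereal_sup_ubound; exists 1%R => //=; exact: ltr01.
  apply: le_ereal_inf_tmp => _ [U [EU _] <-].
  have [i _ Ui] := EU _ Ex.
  rewrite eseries_mkcond (@nneseriesD1 _ _ i)//.
    rewrite ifT; last by apply/set0P; exists x.
    rewrite poweRe0 leeDl// nneseries_ge0// => k _ _.
    by case: ifP => // _; exact: poweR_ge0.
  by move=> k _; case: ifP => // _; exact: poweR_ge0.
by rewrite H0 lee_fin ler10.
Qed.

(** First [J] is taken large, then [j] just above [tau * J / (1 + tau)], so that [j / J] exceeds
    [tau / (1 + tau)] by at most [1 / J]; last comes the prime [p], large enough for [ln W / ln p]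
    to be small. Each of the two errors takes at most half of [gam]. *)
Lemma step_parameters (R : realType) (tau s s' W : R) :
  0 < tau -> s < s' -> 1 <= W ->
  exists p j J : nat, [/\ prime p, (0 < j <= J)%N,
    tau * J%:R <= (1 + tau) * j%:R &
    ln W / (ln p%:R / j%:R * J%:R) + j%:R / J%:R * ((1 + tau) * s) < tau * s'].
Proof.
move=> tau0 ss' W1.
have t1 : 0 < 1 + tau by rewrite addr_gt0.
have [gam gamE gam0] : exists2 gam, gam = (s' - s) * tau & 0 < gam.
  by exists ((s' - s) * tau); rewrite // mulr_gt0// subr_gt0.
pose J := (Num.truncn ((1 + tau) + 2 * (1 + tau) * `|s| / gam)).+1.
have JP : (1 + tau) + 2 * (1 + tau) * `|s| / gam < J%:R by exact: truncnS_gt.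
have JR : 0 < J%:R :> R by rewrite ltr0n.
have snn : 0 <= 2 * (1 + tau) * `|s| / gam.
  by rewrite !mulr_ge0// ?invr_ge0 ltW.
have J1 : 1 + tau <= J%:R by apply: le_trans (ltW JP); rewrite lerDl.
have J2 : 2 * (1 + tau) * `|s| < gam * J%:R.
  rewrite [ltRHS]mulrC -ltr_pdivrMr//; apply: le_lt_trans JP.
  by rewrite lerDr ltW.
pose x := tau * J%:R / (1 + tau).
have x0 : 0 <= x by rewrite divr_ge0 ?mulr_ge0// ltW.
pose j := (Num.truncn x).+1.
have xj : x < j%:R by exact: truncnS_gt.
have jx : j%:R <= x + 1 by rewrite -natr1 lerD2r truncn_le.
have xE : x * (1 + tau) = tau * J%:R by rewrite divfK// gt_eqF.
have jJR : j%:R <= J%:R :> R.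
  apply: (le_trans jx); rewrite -(ler_pM2r t1) mulrDl xE; nra.
have jJ : (0 < j <= J)%N by apply/andP; split; rewrite // -(ler_nat R).
have [p pN pp] := prime_above (Num.truncn (expR (2 * ln W / gam))).
have lnp : 2 * ln W / gam < ln p%:R.
  rewrite -ltr_expR lnK ?posrE ?ltr0n ?prime_gt0//.
  by apply: lt_le_trans (truncnS_gt _) _; rewrite ler_nat.
have lnW : 0 <= ln W by rewrite ln_ge0.
have lnp0 : 0 < ln p%:R :> R.
  by apply: le_lt_trans lnp; rewrite divr_ge0 ?mulr_ge0// ltW.
exists p, j, J; split => //.
  by rewrite -xE mulrC ler_pM2l// ltW.
have j0 : 0 < j%:R :> R by rewrite ltr0n.
have H1 : ln W / (ln p%:R / j%:R * J%:R) < gam / 2.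
  have -> : ln W / (ln p%:R / j%:R * J%:R) = ln W / ln p%:R * (j%:R / J%:R).
    by field; rewrite !gt_eqF.
  apply: (@le_lt_trans _ _ (ln W / ln p%:R)).
    apply: ler_piMr; first by rewrite divr_ge0// ltW.
    by rewrite ler_pdivrMr// mul1r.
  move: lnp; rewrite !ltr_pdivrMr// => H.
  by rewrite mulrAC ltr_pdivlMr// mulrC [ltRHS]mulrC.
have H2 : j%:R / J%:R * ((1 + tau) * s) <= tau * s + gam / 2.
  rewrite mulrAC ler_pdivrMr//.
  have A1 : (j%:R - x) * s <= `|s|.
    have d0 : 0 <= j%:R - x <= 1 by rewrite subr_ge0 ltW//= lerBlDl.
    case/andP: d0 => d0 d1; apply: (le_trans (ler_norm _)).
    by rewrite normrM ger0_norm// ler_piMl.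
  have A2 : j%:R * ((1 + tau) * s) = (j%:R - x) * s * (1 + tau) + tau * J%:R * s.
    by rewrite -xE; ring.
  rewrite A2; have A3 : (j%:R - x) * s * (1 + tau) <= `|s| * (1 + tau).
    by rewrite ler_pM2r.
  lra.
have : tau * s + gam = tau * s' by rewrite gamE; ring.
lra.
Qed.

(** * The dimension bound *)

Section MainBound.
Context {R : realType} {m n : nat}.
Variables (hm : (0 < m)%N) (hn : (0 < n)%N) (A : 'M[R]_(m, n)) (tau : R).
Hypothesis tau0 : 0 < tau.

Definition growth_quotient (delta T : R) : R :=
  (\int[lebesgue_measure]_(S in `[1, T])
      ((small_minima_count A tau S delta)%:R / S)
   - ln (covering_product A (T `^ (- tau)) T)) / ((1 + tau) * ln T).

(** For each [e] a cover at one scale suffices, so it is enough that the quotient falls below [s] at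
    arbitrarily large [T]. The gap between [s] and [s'] absorbs the losses of the steps. *)
Lemma hausdorff_measure_singular (delta s s' : R) : 0 < delta ->
  s < s' -> 0 <= s' ->
  (forall M, exists2 T, M <= T & growth_quotient delta T < s) ->
  hausdorff_measure s' (singular_set A (power_fun tau)) = 0%E.
Proof.
move=> delta0 ss' s'0 freq.
have W1 : 1 <= (33 ^ (m + n))%N%:R :> R by rewrite ler1n expn_gt0.
have [p [j [J [pp /andP[j0 jJ] tauJ kappa]]]] := step_parameters tau0 ss' W1.
set lnW := ln _ in kappa; set eta := ln p%:R / j%:R in kappa.
have p0 : 0 < p%:R :> R by rewrite ltr0n prime_gt0.
have jR : 0 < j%:R :> R by rewrite ltr0n.
have JR : 0 < J%:R :> R by rewrite ltr0n (leq_trans j0).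
have eta0 : 0 < eta by rewrite divr_gt0// ln_gt0// ltr1n prime_gt1.
have etaj : expR (eta * j%:R) = p%:R by rewrite divfK ?lnK ?posrE// gt_eqF.
have [c cE] : exists c, c = delta / (8 * p%:R * expR (tau * eta)) by eexists.
have d0 : 0 < 8 * p%:R * expR (tau * eta) by rewrite !mulr_gt0// expR_gt0.
have c0 : 0 < c by rewrite cE divr_gt0.
have cdelta : 4 * p%:R * c * expR (tau * eta) < delta.
  rewrite (_ : _ * _ = delta / 2); first by lra.
  by rewrite cE; field; rewrite !gt_eqF// expR_gt0.
apply: (hausdorff_measure_eq0 s'0 (singular_set_approximable tau0 c0 eta0)).
move=> i e e0; set E := [set x | _].
have Eapp l : (i <= l)%N -> E `<=` approximable A
    (c * expR (- tau * (eta * l%:R))) (c * expR (eta * l%:R)).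
  by move=> il x; exact.
have [B [T0 BT]] := cover_count hm hn tau0 c0 eta0 pp j0 jJ etaj tauJ cdelta Eapp.
pose D := 4 * (c * expR (tau * (eta * (2 * J%:R)))).
have D0 : 0 < D by rewrite !mulr_gt0// expR_gt0.
(* The decay rate: the number of cells times the power [s'] of their diameter bound is at most
   [expR (B + s' * ln D - kap * ln T)]. Beyond [t1] the diameters are at most [e], beyond [t2] this
   product is. *)
pose kap := tau * s' - (lnW / (eta * J%:R) + j%:R / J%:R * ((1 + tau) * s)).
have kap0 : 0 < kap by rewrite subr_gt0.
pose t1 := (ln D - ln e) / tau.
pose t2 := (B + s' * ln D - ln e) / kap.
pose M := Num.max T0 (expR (1 + `|t1| + `|t2|)).
have [T MT qT] := freq M.
have T0T : T0 <= T by rewrite (le_trans _ MT)// le_max lexx.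
have [a [C [/andP[a0 aT] C2 C3]]] := BT T T0T.
have tT : 1 + `|t1| + `|t2| <= ln T.
  have eT : expR (1 + `|t1| + `|t2|) <= T by rewrite (le_trans _ MT)// le_max lexx orbT.
  by rewrite -ler_expR lnK// posrE (lt_le_trans _ eT)// expR_gt0.
have n1 := normr_ge0 t1; have n2 := normr_ge0 t2.
have lT0 : 0 < ln T by lra.
(* [ln] is 0 at nonpositive arguments. *)
have Tp : 0 < T.
  rewrite ltNge; apply/negP => T0'; move: lT0; rewrite ln0// ltxx//.
have r0 : 0 < 2 * (2 * a) by rewrite !mulr_gt0.
have lnr : ln (2 * (2 * a)) <= ln D - tau * ln T.
  have -> : ln D - tau * ln T = ln (D * T `^ (- tau)).
    by rewrite lnM ?posrE ?powR_gt0// ln_powR mulNr.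
  have DT : 0 < D * T `^ (- tau) by apply: mulr_gt0 => //; rewrite powR_gt0.
  rewrite ler_ln ?posrE//.
  by rewrite /D -[4 * _ * _]mulrA [leLHS]mulrA -natrM ler_pM2l.
have L1 : ln D - ln e <= tau * ln T.
  have := ler_norm t1; rewrite {1}/t1 ler_pdivrMr// => H; apply: (le_trans H).
  by rewrite mulrC ler_pM2l//; lra.
have L2 : B + s' * ln D - ln e <= kap * ln T.
  have := ler_norm t2; rewrite {1}/t2 ler_pdivrMr// => H; apply: (le_trans H).
  by rewrite mulrC ler_pM2l//; lra.
exists (size C), (2 * (2 * a)), (fun l => cell A (nth 0 C l) (2 * a)); split.
- rewrite ltW//= -ler_ln ?posrE//; lra.
- move=> x /C2[z zC xz]; exists (index z C); first by rewrite /= index_mem.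
  by rewrite nth_index.
- by move=> l; apply: diam_cell; rewrite mulr_ge0// ltW.
apply: (le_trans (ler_wpM2r (powR_ge0 _ _) C3)).
have -> : (2 * (2 * a)) `^ s' = expR (s' * ln (2 * (2 * a))).
  by rewrite /powR gt_eqF.
rewrite -expRD -[leRHS]lnK ?posrE// ler_expR -/lnW.
move: qT; rewrite /growth_quotient ltr_pdivrMr ?mulr_gt0 ?addr_gt0//.
set X := _ - ln (covering_product _ _ _) => qT.
have H3 : j%:R / J%:R * X <= j%:R / J%:R * (s * ((1 + tau) * ln T)).
  by rewrite ler_wpM2l ?divr_ge0// ltW.
have H4 : s' * ln (2 * (2 * a)) <= s' * (ln D - tau * ln T) by rewrite ler_wpM2l.
move: L2; rewrite /kap; lra.
Qed.

(** Only the integral depends on [delta], and the denominator is positive for [T > 1]. *)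
Lemma le_growth_quotient (delta delta' T : R) : 1 < T -> delta <= delta' ->
  growth_quotient delta T <= growth_quotient delta' T.
Proof.
move=> T1 dd'; have lT : 0 < (1 + tau) * ln T.
  by rewrite mulr_gt0 ?ln_gt0// addr_gt0.
rewrite /growth_quotient ler_pM2r ?invr_gt0// lerD2r.
have cnt S d : (small_minima_count A tau S d <= m + n)%N.
  by rewrite /small_minima_count size_filter (leq_trans (count_size _ _))// size_iota.
apply: (@le_Rintegral_count _ _ _ (m + n)) => [|S|S _]; [exact: ltW|exact: cnt|].
rewrite /small_minima_count !size_filter; apply: sub_count => i /=.
by move=> /lt_le_trans; apply; rewrite ler_wpM2r// powR_ge0.
Qed.

Let liminf_quotient (delta : R) : \bar R :=
  limf_einf (fun T => (growth_quotient delta T)%:E) (+oo)%R.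

Lemma le_liminf_quotient (delta delta' : R) : delta <= delta' ->
  (liminf_quotient delta <= liminf_quotient delta')%E.
Proof.
move=> dd'; rewrite /liminf_quotient !limf_einfE.
apply: ge_ereal_sup => _ [V [M [Mreal MV]] <-].
pose V' := [set T | Num.max M 1 < T].
apply: (@le_trans _ _ (ereal_inf
    [set (growth_quotient delta' T)%:E | T in V'])).
  apply: le_ereal_inf_tmp => _ [T VT <-].
  move: VT; rewrite /V' /= gt_max => /andP[MT T1].
  apply: (@le_trans _ _ (growth_quotient delta T)%:E).
    by apply: ereal_inf_lbound; exists T => //; exact: MV.
  by rewrite lee_fin le_growth_quotient.
apply: ereal_sup_ubound; exists V' => //.
by exists (Num.max M 1); split => //; rewrite num_real.
Qed.

Lemma liminf_quotient_lt (delta s : R) : (liminf_quotient delta < s%:E)%E ->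
  forall M, exists2 T, M <= T & growth_quotient delta T < s.
Proof.
rewrite /liminf_quotient limf_einfE => Ls M.
have : (ereal_inf [set (growth_quotient delta T)%:E | T in [set T | (M < T)%R]] < s%:E)%E.
  apply: le_lt_trans Ls; apply: ereal_sup_ubound; exists [set T | M < T] => //.
  by exists M; split => //; rewrite num_real.
by move=> /ereal_inf_lt[_ [T /= MT <-]]; rewrite lte_fin => ?; exists T => //; exact: ltW.
Qed.

(** A negative value would allow [s' = 0] and make the zero-dimensional measure of a nonempty set
    vanish. *)
Lemma liminf_quotient_ge0 (delta : R) : 0 < delta ->
  (0 <= liminf_quotient delta)%E.
Proof.
move=> d0; rewrite leNgt; apply/negP => L0.
have [s Ls s0] : exists2 s : R, (liminf_quotient delta < s%:E)%E & s < 0.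
  move: L0; case: (liminf_quotient delta) => [r||]//.
    rewrite lte_fin => r0; exists (r / 2); last by lra.
    by rewrite lte_fin; lra.
  by move=> _; exists (-1); rewrite ?ltNyr// ltrN10.
have := hausdorff_measure_singular d0 s0 (lexx 0) (liminf_quotient_lt Ls).
by apply: hausdorff_measure0_gt0; exact: singular_set_neq0.
Qed.

Lemma hausdorff_dim_singular_le (delta : R) : 0 < delta ->
  (hausdorff_dim (singular_set A (power_fun tau)) <= liminf_quotient delta)%E.
Proof.
move=> d0; have := liminf_quotient_ge0 d0.
case E : (liminf_quotient delta) => [r||]// r0; last by rewrite leey.
apply/lee_addgt0Pr => e e0; apply: ereal_inf_lbound.
rewrite lee_fin in r0.
exists (r + e) => //=; split; first by rewrite addr_ge0// ltW.
apply: (@hausdorff_measure_singular delta (r + e / 2)) => //.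
- by lra.
- by rewrite addr_ge0// ltW.
- by apply: liminf_quotient_lt; rewrite E lte_fin; lra.
Qed.

End MainBound.

Theorem proposition2p7 (R : realType) (m n : nat) (hm : (0 < m)%N)
    (hn : (0 < n)%N) (A : 'M[R]_(m, n)) (tau : R) (htau : 0 < tau) :
  let liminf_quotient (delta : R) : \bar R :=
    limf_einf (fun T : R =>
      ((\int[lebesgue_measure]_(S in `[1, T])
           ((small_minima_count A tau S delta)%:R / S)
         - ln (covering_product A (T `^ (- tau)) T))
       / ((1 + tau) * ln T))%:E) (+oo)%R in
  cvg (liminf_quotient delta @[delta --> 0^'+]) /\
  (hausdorff_dim (singular_set A (power_fun tau))
     <= lim (liminf_quotient delta @[delta --> 0^'+]))%E.
Proof.
move=> L.
(* Monotonicity in [delta] yields the limit from the right at 0; the bound, valid for each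
   [delta > 0], passes to it. *)
have Lcvg : cvg (L delta @[delta --> 0^'+]).
  apply: nondecreasing_at_right_is_cvge; near=> e => x y _ _.
  exact: le_liminf_quotient.
split => //; apply: lime_ge => //.
by near=> delta; apply: hausdorff_dim_singular_le.
Unshelve. all: by end_near. Qed.
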